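(* Let $\mathcal{R}$ be a commutative ring with identity with $\frac12\in\mathcal{R}$, let $\mathcal{T}=\begin{bmatrix} A & M\\ 0 & B\end{bmatrix}$ and $\mathcal{T}'=\begin{bmatrix} A' & M'\\ 0 & B'\end{bmatrix}$ be two triangular algebras over $\mathcal{R}$, and let $\mathfrak{l}\colon\mathcal{T}\to\mathcal{T}'$ be a Lie triple isomorphism. Suppose that (1) each commuting linear mapping on $A'$ or $B'$ is proper; (2) $\pi_{A'}(\mathcal{Z}(\mathcal{T}'))=\mathcal{Z}(A')\neq A'$ and $\pi_{B'}(\mathcal{Z}(\mathcal{T}'))=\mathcal{Z}(B')\neq B'$; (3) either $A$ or $B$ is noncommutative; (4) $M'$ is loyal. Then $\mathfrak{l}=\pm\mathfrak{m}+\mathfrak{n}$ (that is, $\mathfrak{l}=\mathfrak{m}+\mathfrak{n}$ or $\mathfrak{l}=-\mathfrak{m}+\mathfrak{n}$), where $\mathfrak{m}\colon\mathcal{T}\to\mathcal{T}'$ is an injective Jordan homomorphism and $\mathfrak{n}\colon\mathcal{T}\to\mathcal{Z}(\mathcal{T}')$ is an $\mathcal{R}$-linear mapping vanishing on each second commutator $[[x,y],z]$, $x,y,z\in\mathcal{T}$. Moreover, if $\mathcal{T}'$ is central over $\mathcal{R}$, then $\mathfrak{m}$ is onto.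
   Context: Let $\mathcal{R}$ be a commutative ring with identity. $\mathcal{Z}(\cdot)$ denotes the center of an algebra, $[x,y]=xy-yx$ and $x\circ y=xy+yx$. Triangular algebra: $A,B$ are unital associative $\mathcal{R}$-algebras and $M$ is a unital $(A,B)$-bimodule which is faithful as a left $A$-module and as a right $B$-module; $\mathcal{T}=\begin{bmatrix} A & M\\ 0 & B\end{bmatrix}$ is the $\mathcal{R}$-algebra of all matrices $\begin{bmatrix} a & m\\ 0 & b\end{bmatrix}$ with $a\in A$, $m\in M$, $b\in B$, under matrix operations. The maps $\pi_A\colon\mathcal{T}\to A$ and $\pi_B\colon\mathcal{T}\to B$ send such a matrix to $a$ and to $b$, respectively. The bimodule $M$ is loyal if for $a\in A$, $b\in B$, $aMb=0$ implies $a=0$ or $b=0$. For a unital $\mathcal{R}$-algebra $\mathcal{A}$, an $\mathcal{R}$-linear mapping $f\colon\mathcal{A}\to\mathcal{A}$ is commuting if $[f(a),a]=0$ for all $a\in\mathcal{A}$; it is proper if there are $z\in\mathcal{Z}(\mathcal{A})$ and an $\mathcal{R}$-linear mapping $\mu\colon\mathcal{A}\to\mathcal{Z}(\mathcal{A})$ with $f(a)=za+\mu(a)$ for all $a$. $\mathcal{A}$ is central over $\mathcal{R}$ if $\mathcal{Z}(\mathcal{A})=\mathcal{R}1$. A Lie triple isomorphism $\mathfrak{l}\colon\mathcal{A}\to\mathcal{B}$ is an $\mathcal{R}$-linear bijective mapping with $\mathfrak{l}([[a,b],c])=[[\mathfrak{l}(a),\mathfrak{l}(b)],\mathfrak{l}(c)]$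 for all $a,b,c\in\mathcal{A}$. A Jordan homomorphism is an $\mathcal{R}$-linear mapping $\mathfrak{m}$ with $\mathfrak{m}(x\circ y)=\mathfrak{m}(x)\circ\mathfrak{m}(y)$ for all $x,y$. *)

(* Defs.v *)
From HB Require Import structures.
From mathcomp Require Import all_boot all_algebra.
From mathcomp Require Import classical_sets.

Set Implicit Arguments.
Unset Strict Implicit.
Unset Printing Implicit Defensive.

Import GRing.Theory.
Local Open Scope ring_scope.
Local Open Scope classical_set_scope.

(* Unital (A, B)-bimodules over R-algebras.  The R-module structure of M is
   part of the data; [lactZl] and [ractZl] with [lact1], [ract1] say that it is
   the one induced by both actions, i.e. (k 1_A) m = k m = m (k 1_B). *)
HB.mixin Record Lmodule_isBimodule (R : comNzRingType) (A B : algType R) M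
    of GRing.Lmodule R M := {
  lact : A -> M -> M;
  ract : M -> B -> M;
  lactA : forall a a' m, lact (a * a') m = lact a (lact a' m);
  lact1 : forall m, lact 1 m = m;
  lactDl : forall a a' m, lact (a + a') m = lact a m + lact a' m;
  lactDr : forall a m m', lact a (m + m') = lact a m + lact a m';
  lactZl : forall (k : R) a m, lact (k *: a) m = k *: lact a m;
  lactZr : forall (k : R) a m, lact a (k *: m) = k *: lact a m;
  ractA : forall m b b', ract m (b * b') = ract (ract m b) b';
  ract1 : forall m, ract m 1 = m;
  ractDl : forall m m' b, ract (m + m') b = ract m b + ract m' b;
  ractDr : forall m b b', ract m (b + b') = ract m b + ract m b';
  ractZl : forall (k : R) m b, ract (k *: m) b = k *: ract m b;
  ractZr : forall (k : R) m b, ract m (k *: b) = k *: ract m b;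
  lractA : forall a m b, ract (lact a m) b = lact a (ract m b)
}.

#[short(type="bimodType")]
HB.structure Definition Bimodule (R : comNzRingType) (A B : algType R) :=
  {M of GRing.Lmodule R M & Lmodule_isBimodule R A B M}.

Section BimoduleProperties.
Variables (R : comNzRingType) (A B : algType R) (M : bimodType A B).

Definition left_faithful := forall a : A, (forall m : M, lact a m = 0) -> a = 0.

Definition right_faithful := forall b : B, (forall m : M, ract m b = 0) -> b = 0.

Definition loyal := forall (a : A) (b : B),
  (forall m : M, ract (lact a m) b = 0) -> a = 0 \/ b = 0.

End BimoduleProperties.

Arguments left_faithful {R A B} M.
Arguments right_faithful {R A B} M.
Arguments loyal {R A B} M.

(* [Triangular a m b] is the upper triangular matrix with rows (a, m), (0, b). *)
Record triangular (R : comNzRingType) (A B : algType R) (M : bimodType A B) :=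
  Triangular { pi_A : A; pi_M : M; pi_B : B }.

Arguments triangular {R A B} M.
Arguments Triangular {R A B M} _ _ _.
Arguments pi_A {R A B M} _.
Arguments pi_M {R A B M} _.
Arguments pi_B {R A B M} _.

Section TriangularAlgebra.
Variables (R : comNzRingType) (A B : algType R) (M : bimodType A B).
Local Notation T := (triangular M).
Implicit Types x y z : T.

Definition prod_of_tri x : A * M * B := (pi_A x, pi_M x, pi_B x).
Definition tri_of_prod (p : A * M * B) : T := Triangular p.1.1 p.1.2 p.2.

Lemma prod_of_triK : cancel prod_of_tri tri_of_prod.
Proof. by case. Qed.

HB.instance Definition _ := Choice.copy T (can_type prod_of_triK).

Definition tri_zero : T := Triangular 0 0 0.
Definition tri_opp x : T := Triangular (- pi_A x) (- pi_M x) (- pi_B x).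
Definition tri_add x y : T :=
  Triangular (pi_A x + pi_A y) (pi_M x + pi_M y) (pi_B x + pi_B y).
Definition tri_scale (k : R) x : T :=
  Triangular (k *: pi_A x) (k *: pi_M x) (k *: pi_B x).
Definition tri_one : T := Triangular 1 0 1.
Definition tri_mul x y : T :=
  Triangular (pi_A x * pi_A y)
             (lact (pi_A x) (pi_M y) + ract (pi_M x) (pi_B y))
             (pi_B x * pi_B y).

Fact tri_addA : associative tri_add.
Proof. by move=> x y z; rewrite /tri_add /= !addrA. Qed.

Fact tri_addC : commutative tri_add.
Proof.
by move=> x y; rewrite /tri_add addrC [pi_M x + _]addrC [pi_B x + _]addrC.
Qed.

Fact tri_add0 : left_id tri_zero tri_add.
Proof. by case=> a m b; rewrite /tri_add /= !add0r. Qed.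

Fact tri_addN : left_inverse tri_zero tri_opp tri_add.
Proof. by move=> x; rewrite /tri_add /= !addNr. Qed.

HB.instance Definition _ :=
  GRing.isZmodule.Build T tri_addA tri_addC tri_add0 tri_addN.

Fact lact0 (a : A) : lact a (0 : M) = 0.
Proof. by apply: (addrI (lact a (0 : M))); rewrite -lactDr !addr0. Qed.

Fact ract0 (b : B) : ract (0 : M) b = 0.
Proof. by apply: (addrI (ract (0 : M) b)); rewrite -ractDl !addr0. Qed.

Fact tri_mulA : associative tri_mul.
Proof.
move=> x y z; rewrite /tri_mul /= !mulrA lactDr ractDl lactA ractA lractA.
by rewrite addrA.
Qed.

Fact tri_mul1 : left_id tri_one tri_mul.
Proof. by case=> a m b; rewrite /tri_mul /= !mul1r lact1 ract0 addr0. Qed.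

Fact tri_mulr1 : right_id tri_one tri_mul.
Proof. by case=> a m b; rewrite /tri_mul /= !mulr1 ract1 lact0 add0r. Qed.

Fact tri_mulDl : left_distributive tri_mul +%R.
Proof.
by move=> x y z; rewrite /tri_mul [LHS]/= !mulrDl lactDl ractDl addrACA.
Qed.

Fact tri_mulDr : right_distributive tri_mul +%R.
Proof.
by move=> x y z; rewrite /tri_mul [LHS]/= !mulrDr lactDr ractDr addrACA.
Qed.

Fact tri_one_neq0 : tri_one != 0 :> T.
Proof. by apply/eqP => /(congr1 pi_A) /eqP; rewrite /= oner_eq0. Qed.

HB.instance Definition _ := GRing.Zmodule_isNzRing.Build T
  tri_mulA tri_mul1 tri_mulr1 tri_mulDl tri_mulDr tri_one_neq0.

Fact tri_scaleA (k l : R) x : tri_scale k (tri_scale l x) = tri_scale (k * l) x.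
Proof. by rewrite /tri_scale /= !scalerA. Qed.

Fact tri_scale1 : left_id 1 tri_scale.
Proof. by case=> a m b; rewrite /tri_scale /= !scale1r. Qed.

Fact tri_scaleDr : right_distributive tri_scale +%R.
Proof. by move=> k x y; rewrite /tri_scale [LHS]/= !scalerDr. Qed.

Fact tri_scaleDl x : {morph tri_scale^~ x : k l / k + l}.
Proof. by move=> k l; rewrite /tri_scale !scalerDl. Qed.

HB.instance Definition _ := GRing.Zmodule_isLmodule.Build R T
  tri_scaleA tri_scale1 tri_scaleDr tri_scaleDl.

Fact tri_scaleAl (k : R) x y : k *: (x * y) = (k *: x) * y.
Proof.
by congr Triangular; rewrite /= ?scalerAl // scalerDr lactZl ractZl.
Qed.

HB.instance Definition _ := GRing.Lmodule_isLalgebra.Build R T tri_scaleAl.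

Fact tri_scaleAr (k : R) x y : k *: (x * y) = x * (k *: y).
Proof.
by congr Triangular; rewrite /= ?scalerAr // scalerDr lactZr ractZr.
Qed.

HB.instance Definition _ := GRing.Lalgebra_isAlgebra.Build R T tri_scaleAr.

End TriangularAlgebra.

Section Algebras.
Variables (R : comNzRingType) (A : algType R).

Definition comm_br (x y : A) : A := x * y - y * x.
Definition jordan_mul (x y : A) : A := x * y + y * x.

Definition center : set A := [set z | forall x : A, z * x = x * z].

Definition central_over : Prop := center = range (fun k : R => k%:A).

Definition commuting (f : A -> A) : Prop := forall a, comm_br (f a) a = 0.

Definition proper_map (f : A -> A) : Prop :=
  exists (z : A) (mu : {linear A -> A}),
    [/\ center z, forall a, center (mu a) & forall a, f a = z * a + mu a].

End Algebras.

Arguments center {R} A.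
Arguments central_over {R} A.

Section Morphisms.
Variables (R : comNzRingType) (A B : algType R).

Definition lie_triple_isomorphism (l : {linear A -> B}) : Prop :=
  bijective l /\
  forall a b c, l (comm_br (comm_br a b) c) = comm_br (comm_br (l a) (l b)) (l c).

Definition jordan_homomorphism (m : {linear A -> B}) : Prop :=
  forall x y, m (jordan_mul x y) = jordan_mul (m x) (m y).

End Morphisms.

(* Main.v *)
(* The Lie triple isomorphism carries the Jordan product of T to a symmetric
   bilinear map D(x, y) = l (l^-1 x o l^-1 y) on T', where x o y = xy + yx;
   the identity [x o y, w] + [y o w, x] + [w o x, y] = 0 makes the cyclic sum of
   the [D(x, y), w] central.  Comparing the A', M' and B' components of this
   condition, and using that commuting linear maps on A' and B' are proper,
   gives D(x, y) = z (x o y) + mu(x) y + mu(y) x modulo the center, with z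
   central and mu central-valued.  Hence phi(x) = z x + mu(x)/2 satisfies
   phi(D(x, y)) = phi(x) o phi(y) up to a central error; the Jordan identity
   (x^2 o y) o x = x^2 o (y o x) turns a nonzero error into quadratic equations
   satisfied by too many elements of T', so the error vanishes and m = phi o l is
   a Jordan homomorphism.  Comparing m and l on second commutators yields
   z^3 = z, and z <> 0, so z = 1 or z = -1. *)

From HB Require Import structures.
Require Import Defs.
From mathcomp Require Import all_boot all_algebra.
From mathcomp Require Import boolp classical_sets.

Set Implicit Arguments.
Unset Strict Implicit.
Unset Printing Implicit Defensive.

Import GRing.Theory.
Local Open Scope ring_scope.
Local Open Scope classical_set_scope.

(** * Identities in noncommutative rings with central elements *)

(** The map [l] is controlled on second commutators only. An identity of T with a single bracket is
    therefore used after one further bracket with an arbitrary element, and in T' it asserts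
    centrality rather than vanishing. Since 3 may be a zero divisor, the cyclic sum at x = y = w
    does not yield centrality of [D(x, x), x], which is derived separately from [x o x, x] = 0. Two
    devices keep the corners apart: a central element of A' or B' extends to a central element of
    T', so a centrally valued term of one corner can be moved to the other; and loyalty makes
    nonzero central elements cancellable. [D] carries two structures. As a transported Jordan
    product it satisfies the Jordan identity, and [[x, y], w] = D(x, D(y, w)) - D(y, D(x, w))
    recovers the Lie triple product of T'; this formula excludes z = 0. The shape of phi comes from
    completing the square: z D(x, y) and phi(x) o phi(y) agree up to a central term exactly when mu
    is halved. *)

Inductive ncexp :=
  NCvar of nat | NC0 | NC1
| NCadd of ncexp & ncexp | NCopp of ncexp | NCmul of ncexp & ncexp.

(* An expression is a difference of two sums of words. *)
Fixpoint nc_words (e : ncexp) : seq (seq nat) * seq (seq nat) :=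
  match e with
  | NCvar i => ([:: [:: i]], [::])
  | NC0 => ([::], [::])
  | NC1 => ([:: [::]], [::])
  | NCadd e1 e2 =>
      let: (p1, n1) := nc_words e1 in let: (p2, n2) := nc_words e2 in
      (p1 ++ p2, n1 ++ n2)
  | NCopp e1 => let: (p, n) := nc_words e1 in (n, p)
  | NCmul e1 e2 =>
      let: (p1, n1) := nc_words e1 in let: (p2, n2) := nc_words e2 in
      (allpairs cat p1 p2 ++ allpairs cat n1 n2,
       allpairs cat p1 n2 ++ allpairs cat n1 p2)
  end.

(* The variables of index less than k are central. *)
Definition nc_sort (k : nat) (w : seq nat) : seq nat :=
  sort leq [seq i <- w | (i < k)%N] ++ [seq i <- w | (k <= i)%N].

Definition nc_eq (k : nat) (e1 e2 : ncexp) : bool :=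
  let: (p1, n1) := nc_words e1 in let: (p2, n2) := nc_words e2 in
  perm_eq (map (nc_sort k) (p1 ++ n2)) (map (nc_sort k) (p2 ++ n1)).

Section NoncommutativeEval.
Variable A : nzRingType.
Implicit Types (env cs : seq A) (w : seq nat) (s : seq (seq nat)).

Fixpoint nc_eval env (e : ncexp) : A :=
  match e with
  | NCvar i => nth 0 env i
  | NC0 => 0
  | NC1 => 1
  | NCadd e1 e2 => nc_eval env e1 + nc_eval env e2
  | NCopp e1 => - nc_eval env e1
  | NCmul e1 e2 => nc_eval env e1 * nc_eval env e2
  end.

Fixpoint all_central cs : Prop :=
  if cs is c :: cs' then (forall x, c * x = x * c) /\ all_central cs' else True.

Lemma all_central_nth cs env i :
  all_central cs -> (i < size cs)%N ->
  forall x, nth 0 (cs ++ env) i * x = x * nth 0 (cs ++ env) i.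
Proof.
by elim: cs i => [//|c cs IH] [|i] /= [cc cent] //; rewrite ltnS; apply: IH.
Qed.

Definition nc_word env w : A := \prod_(i <- w) nth 0 env i.
Definition nc_sum env s : A := \sum_(w <- s) nc_word env w.

Lemma nc_sum_allpairs env s1 s2 :
  nc_sum env (allpairs cat s1 s2) = nc_sum env s1 * nc_sum env s2.
Proof.
rewrite /nc_sum big_allpairs_dep mulr_suml; apply: eq_bigr => w1 _.
by rewrite mulr_sumr; apply: eq_bigr => w2 _; rewrite /nc_word big_cat.
Qed.

Lemma nc_wordsP env e :
  nc_eval env e =
    nc_sum env (nc_words e).1 - nc_sum env (nc_words e).2.
Proof.
elim: e => [i|||e1 + e2|e|e1 + e2] /=;
  rewrite ?/nc_sum ?big_nil ?big_seq1 ?subr0 //.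
- by rewrite /nc_word big_seq1.
- by rewrite /nc_word big_nil.
- case: (nc_words e1) (nc_words e2) => [p1 n1] [p2 n2] /= -> ->.
  by rewrite !big_cat /= opprD addrACA.
- by case: (nc_words e) => p n /= ->; rewrite opprB.
case: (nc_words e1) (nc_words e2) => [p1 n1] [p2 n2] /= -> ->.
rewrite !big_cat /= -!/(nc_sum _ _) !nc_sum_allpairs mulrBl !mulrBr.
by rewrite opprB addrACA -opprD.
Qed.

Lemma nc_word_sort cs env w :
  all_central cs -> nc_word (cs ++ env) (nc_sort (size cs) w) = nc_word (cs ++ env) w.
Proof.
move=> cent; have centP := all_central_nth env cent.
set f := nth 0 (cs ++ env) in centP *.
have perm_prod (s1 s2 : seq nat) : all (fun i => i < size cs)%N s1 -> perm_eq s1 s2 ->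
    nc_word (cs ++ env) s1 = nc_word (cs ++ env) s2.
  elim: s1 s2 => [|i s1 IH] s2 /=; first by rewrite perm_sym => _ /perm_nilP ->.
  move=> /andP[ik s1k] /[dup] /perm_mem/(_ i); rewrite mem_head => /esym.
  case/splitPr => t1 t2.
  rewrite perm_sym -(cat1s i t2) perm_catCA perm_cons perm_sym.
  move=> /(IH _ s1k); rewrite /nc_word big_cons !big_cat big_seq1 /= -/f => ->.
  by rewrite mulrA centP // -mulrA.
rewrite /nc_sort {1}/nc_word big_cat /= -!/(nc_word _ _).
rewrite (perm_prod _ [seq i <- w | (i < size cs)%N]) ?perm_sort //; last first.
  by rewrite all_sort filter_all.
elim: w => [|i w IH] /=; first by rewrite /nc_word !big_nil mulr1.
case: ltnP => ik; rewrite /nc_word !big_cons -?/(nc_word _ _) -IH ?mulrA //.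
rewrite -!/(f _); congr (_ * _).
(* The noncentral first letter still has to pass through the central prefix. *)
elim: (w) => [|j v IHv] /=; first by rewrite /nc_word !big_nil mulr1 mul1r.
case: ifP => // jk; rewrite /nc_word !big_cons -?/(nc_word _ _) -/f.
by rewrite -mulrA IHv !mulrA centP.
Qed.

Lemma nc_eqP cs env e1 e2 :
  all_central cs -> nc_eq (size cs) e1 e2 ->
  nc_eval (cs ++ env) e1 = nc_eval (cs ++ env) e2.
Proof.
move=> cent; rewrite /nc_eq !nc_wordsP.
case: (nc_words e1) (nc_words e2) => [p1 n1] [p2 n2] /= eq_words.
have sortE s :
    \sum_(w <- map (nc_sort (size cs)) s) nc_word (cs ++ env) w
    = nc_sum (cs ++ env) s.
  by rewrite big_map; apply: eq_bigr => w _; apply: nc_word_sort.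
apply/eqP; rewrite subr_eq addrAC eq_sym subr_eq; apply/eqP.
move: (sortE (p1 ++ n2)) (sortE (p2 ++ n1)).
by rewrite (perm_big _ eq_words) /= => ->; rewrite /nc_sum !big_cat /= => ->.
Qed.

End NoncommutativeEval.

Ltac nc_find x l :=
  lazymatch l with
  | cons x _ => constr:(O)
  | cons _ ?l' => let n := nc_find x l' in constr:(S n)
  end.

Ltac nc_mem x l :=
  lazymatch l with
  | nil => constr:(false)
  | cons x _ => constr:(true)
  | cons _ ?l' => nc_mem x l'
  end.

(** New atoms are appended at the end: the search starts from the list of central elements, which
    thus keep the small indices that [nc_sort] treats as central. *)
Ltac nc_atoms env t :=
  lazymatch t with
  | (?x + ?y)%R => let env1 := nc_atoms env x in nc_atoms env1 y
  | (?x * ?y)%R => let env1 := nc_atoms env x in nc_atoms env1 y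
  | (- ?x)%R => nc_atoms env x
  | 0%R => env
  | 1%R => env
  | _ => lazymatch nc_mem t env with
         | true => env
         | false => let T := type of t in
           let rec app l := lazymatch l with
             | cons ?a ?l' => let r := app l' in constr:(cons a r)
             | nil => constr:(cons t nil) end in app env
         end
  end.

Ltac nc_reify env t :=
  lazymatch t with
  | (?x + ?y)%R =>
      let a := nc_reify env x in let b := nc_reify env y in constr:(NCadd a b)
  | (?x * ?y)%R =>
      let a := nc_reify env x in let b := nc_reify env y in constr:(NCmul a b)
  | (- ?x)%R => let a := nc_reify env x in constr:(NCopp a)
  | 0%R => constr:(NC0)
  | 1%R => constr:(NC1)
  | _ => let n := nc_find t env in constr:(NCvar n)
  end.

Ltac nc_drop cs env :=
  lazymatch cs with
  | nil => env
  | cons _ ?cs' => lazymatch env with cons _ ?env' => nc_drop cs' env' end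
  end.

Ltac nc_central cs :=
  lazymatch cs with
  | nil => exact I
  | cons ?c ?cs' =>
      refine (conj _ _); [ match goal with H : center _ c |- _ => exact H end
                         | nc_central cs' ]
  end.

(* Proves an identity that holds in all rings in which the members of the
   list cs are central; their centrality is looked up in the context. *)
Ltac ncring cs :=
  lazymatch goal with
  | |- @eq ?T ?x ?y =>
      let cs0 := constr:(cs : seq T) in
      let cs1 := eval cbv beta in cs0 in
      let cs2 := lazymatch cs1 with (?c : _) => c | ?c => c end in
      let env1 := nc_atoms cs2 x in
      let env := nc_atoms env1 y in
      let env' := nc_drop cs2 env in
      let ex := nc_reify env x in let ey := nc_reify env y in
      apply: (@nc_eqP _ cs2 env' ex ey); [ nc_central cs2 | by vm_compute ]
  end.

(** * Central torsion-free algebras *)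

Lemma double_eq0 (R : comNzRingType) (half_R : exists h : R, h *+ 2 = 1)
  (V : lmodType R) (v : V) : v + v = 0 -> v = 0.
Proof.
case: half_R => h h2 vv.
by rewrite -[v]scale1r -h2 mulr2n scalerDl -scalerDr vv scaler0.
Qed.

Lemma double_inj (R : comNzRingType) (half_R : exists h : R, h *+ 2 = 1)
  (V : lmodType R) (u v : V) : u + u = v + v -> u = v.
Proof.
move=> uv; apply/eqP; rewrite -subr_eq0; apply/eqP/(double_eq0 half_R).
by rewrite addrACA uv -opprD subrr.
Qed.

Lemma additive0 (U V : zmodType) (f : U -> V) : {morph f : x y / x + y} -> f 0 = 0.
Proof. by move=> fD; apply: (addrI (f 0)); rewrite -fD !addr0. Qed.

Lemma additiveN (U V : zmodType) (f : U -> V) :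
  {morph f : x y / x + y} -> {morph f : x / - x}.
Proof.
by move=> fD x; apply: (addrI (f x)); rewrite -fD !subrr (additive0 fD).
Qed.

Section Center.
Variables (R : comNzRingType) (A : algType R).
Implicit Types c d x : A.

Lemma center0 : center A 0. Proof. by move=> x; rewrite mul0r mulr0. Qed.

Lemma center1 : center A 1. Proof. by move=> x; rewrite mul1r mulr1. Qed.

Lemma centerD c d : center A c -> center A d -> center A (c + d).
Proof. by move=> cc cd x; rewrite mulrDl cc cd mulrDr. Qed.

Lemma centerN c : center A c -> center A (- c).
Proof. by move=> cc x; rewrite mulNr cc mulrN. Qed.

Lemma centerB c d : center A c -> center A d -> center A (c - d).
Proof. by move=> cc cd; apply/centerD/centerN. Qed.

Lemma centerM c d : center A c -> center A d -> center A (c * d).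
Proof. by move=> cc cd x; rewrite -mulrA cd mulrA cc mulrA. Qed.

Lemma centerZ (k : R) c : center A c -> center A (k *: c).
Proof. by move=> cc x; rewrite -scalerAl cc scalerAr. Qed.

Lemma center_neq_setT : center A <> [set: A] -> exists x, ~ center A x.
Proof.
move=> neq; apply: contrapT => central; apply: neq; apply/seteqP; split=> // x _.
by apply: contrapT => ncx; apply: central; exists x.
Qed.

Lemma not_centerP x : ~ center A x -> exists y, x * y - y * x <> 0.
Proof.
move=> ncx; apply: contrapT => comm; apply: ncx => y.
by apply: contrapT => ncxy; apply: comm; exists y => /subr0_eq.
Qed.

End Center.

(** Loyalty provides this for both diagonal corners; it permits cancelling central coefficients
    there. *)
Definition central_torsion_free (R : comNzRingType) (A : algType R) :=
  forall c x : A, center A c -> c * x = 0 -> c = 0 \/ x = 0.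

Section CentralTorsionFree.
Variables (R : comNzRingType) (half_R : exists h : R, h *+ 2 = 1).
Variables (A : algType R) (torsionA : central_torsion_free A).

Lemma central_mul_central (c x : A) :
  center A c -> center A (c * x) -> c = 0 \/ center A x.
Proof.
move=> cc ccx; have [|cN0] := pselect (c = 0); [by left | right=> y].
have /(torsionA cc)[//|/subr0_eq //] : c * (x * y - y * x) = 0.
have -> : c * (x * y - y * x) = (c * x) * y - y * (c * x) by ncring [:: c].
by rewrite ccx subrr.
Qed.

Lemma central_sqr_eq0 (c : A) : center A c -> c * c = 0 -> c = 0.
Proof. by move=> cc /(torsionA cc)[]. Qed.

(** Put z = [f a, a]. The condition at a, a * a and a + a * a gives [f (a * a), a] = p - 2 z a with
    p central, so q = [f (a * a), a * a] = 2 p a - 4 z a * a is central. Bracketing this with f a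
    twice leaves 8 z^3 = 0. *)
Lemma centralizing_additive_commuting (f : A -> A) :
    {morph f : x y / x + y} ->
    (forall a, center A (f a * a - a * f a)) ->
  forall a, f a * a = a * f a.
Proof.
move=> fD centralizing a; pose u := f a; pose v := f (a * a).
have [z zE] : exists z, z = u * a - a * u by eexists.
have cz : center A z by rewrite zE; apply: centralizing.
have [p pE] : exists p, p = v * a - a * v + (u * (a * a) - a * a * u).
  by eexists.
have cp : center A p.
  suff -> : p = (f (a + a * a) * (a + a * a) - (a + a * a) * f (a + a * a))
               - z - (f (a * a) * (a * a) - (a * a) * f (a * a)).
    by apply: centerB; [apply: centerB => // |]; apply: centralizing.
  by rewrite pE zE fD -/u -/v; ncring (@nil A).
have [q qE] : exists q, q = v * (a * a) - (a * a) * v by eexists.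
have cq : center A q by rewrite qE; apply: centralizing.
have vaE : v * a - a * v = p - (z * a + z * a).
  by rewrite {1}cz pE zE; ncring (@nil A).
have {}qE : q = p * a + p * a - (z * a * a + z * a * a + (z * a * a + z * a * a)).
  have -> : q = (v * a - a * v) * a + a * (v * a - a * v).
    by rewrite qE; ncring (@nil A).
  by rewrite vaE; ncring [:: p; z].
pose r := z * z * a + z * z * a.
have comm_q : p * z + p * z - (r + r + (r + r)) = 0.
  have -> : r = z * ((u * a - a * u) * a + a * (u * a - a * u)).
    by rewrite /r -zE; ncring [:: z].
  by rewrite -(subrr (u * q)) -{2}cq qE [X in p * X]zE; ncring [:: p; z].
have z3 : z * (z * z) = 0.
  pose s := z * (z * z) + z * (z * z).
  have s4 : s + s + (s + s) = 0.
    transitivity (- (u * 0 - 0 * u)); last by rewrite mulr0 mul0r subrr oppr0.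
    by rewrite -comm_q /s /r [X in z * (z * X)]zE; ncring [:: p; z].
  by do 3!apply: (double_eq0 half_R).
have z0 : z = 0.
  by have [//|/central_sqr_eq0 ->] := torsionA cz z3.
by apply/eqP; rewrite -subr_eq0 -zE z0.
Qed.

(** With z = [u, a], the commutator [u, a * a] = 2 z a is central; bracketing it with u gives 2 z^2
    = 0. *)
Lemma center_of_central_commutators (u : A) :
  (forall a, center A (u * a - a * u)) -> center A u.
Proof.
move=> cu a; have [z zE] : exists z, z = u * a - a * u by eexists.
have cz : center A z by rewrite zE.
apply/eqP; rewrite -subr_eq0 -zE; apply/eqP/(central_sqr_eq0 cz).
apply: (double_eq0 half_R).
have := cu (a * a) u.
have -> : u * (a * a) - a * a * u = (u * a - a * u) * a + a * (u * a - a * u).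
  by ncring (@nil A).
rewrite -zE => /esym/eqP; rewrite -subr_eq0 => /eqP <-.
by rewrite {2 4}zE; ncring [:: z].
Qed.

Hypothesis noncentral : exists a, ~ center A a.

(* The elements delta x anticommute and square to zero, so the products
   delta x * delta y are central of square zero, hence vanish; then c * x is
   central for every x. *)
Lemma square_zero_central_family (delta gamma : A -> A) (c : A) :
    {morph delta : x y / x + y} -> (forall x, delta x * delta x = 0) ->
    center A c -> (forall x, center A (gamma x)) ->
    (forall x, delta x = gamma x - c * x) ->
  c = 0 /\ forall x, gamma x = 0.
Proof.
move=> deltaD delta2 cc cg deltaE.
have c0 : c = 0.
  apply: contrapT => cN0; case: noncentral => a; apply=> b.
  have anti x y : delta x * delta y = - (delta y * delta x).
    apply/eqP; rewrite -addr_eq0 -(delta2 (x + y)) deltaD; apply/eqP.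
    transitivity (delta x * delta y + delta y * delta x
                  + (delta x * delta x + delta y * delta y)).
      by rewrite !delta2 !addr0.
    by ncring (@nil A).
  (* Two anticommutations cancel, so [delta x * delta y] commutes with [delta t], which is [- c * t]
     up to a central term. *)
  have prod_center x y : center A (delta x * delta y).
    move=> t; apply/subr0_eq.
    have comm_t : delta x * delta y * delta t = delta t * (delta x * delta y).
      by rewrite -mulrA (anti y t) mulrN [X in - X]mulrA (anti x t) mulNr opprK mulrA.
    have /(torsionA cc)[] // :
        c * (delta x * delta y * t - t * (delta x * delta y)) = 0.
    have -> : c * (delta x * delta y * t - t * (delta x * delta y)) =
        delta t * (delta x * delta y) - delta x * delta y * delta t.
      by rewrite (deltaE t); have cgt := cg t; ncring [:: gamma t; c].
    by rewrite comm_t subrr.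
  have prod0 x y : delta x * delta y = 0.
    apply: central_sqr_eq0; first exact: prod_center.
    by rewrite {1}anti mulNr -mulrA [delta x * (_ * _)]mulrA delta2 mul0r mulr0 oppr0.
  have c2 : c * (c * (a * b - b * a)) = 0.
    have -> : c * (c * (a * b - b * a)) =
        (gamma a - delta a) * (gamma b - delta b)
        - (gamma b - delta b) * (gamma a - delta a).
      by rewrite !deltaE; have ca := cg a; have cb := cg b;
         ncring [:: c; gamma a; gamma b].
    rewrite -[RHS](subrr 0) -{1}(prod0 a b) -{1}(prod0 b a).
    by have ca := cg a; have cb := cg b; ncring [:: gamma a; gamma b].
  have [//|/(torsionA cc)[//|/subr0_eq //]] := torsionA cc c2.
split=> // x; apply: central_sqr_eq0 => //.
by rewrite -[RHS](delta2 x) deltaE c0 mul0r subr0.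
Qed.

End CentralTorsionFree.

(** * Functional identities at a corner of a triangular algebra *)

(* Covers both the left A-module and the right B-module M: only products of
   commuting elements are required to act multiplicatively. *)
Record corner_action (R : comNzRingType) (A : algType R) (V : lmodType R)
    (act : A -> V -> V) : Prop := CornerAction {
  cactDl : forall a b v, act (a + b) v = act a v + act b v;
  cactDr : forall a u v, act a (u + v) = act a u + act a v;
  cactZl : forall (k : R) a v, act (k *: a) v = k *: act a v;
  cactZr : forall (k : R) a v, act a (k *: v) = k *: act a v;
  cact1 : forall v, act 1 v = v;
  cactM : forall a b v, a * b = b * a -> act (a * b) v = act a (act b v);
  cact_faithful : forall a, (forall v, act a v = 0) -> a = 0
}.

Section CornerIdentities.
Variables (R : comNzRingType) (half_R : exists h : R, h *+ 2 = 1).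
Variables (A : algType R) (torsionA : central_torsion_free A).
Hypothesis noncentral : exists a, ~ center A a.
Variables (V : lmodType R) (act : A -> V -> V) (actP : corner_action act).

Lemma cactN a v : act (- a) v = - act a v.
Proof. exact: (additiveN (fun x y => cactDl actP x y v)). Qed.

Lemma cactB a b v : act (a - b) v = act a v - act b v.
Proof. by rewrite (cactDl actP) cactN. Qed.

Lemma cact0r a : act a 0 = 0.
Proof. exact: (additive0 (cactDr actP a)). Qed.

Lemma cact_inj a b : (forall v, act a v = act b v) -> a = b.
Proof.
move=> ab; apply/eqP; rewrite -subr_eq0; apply/eqP/(cact_faithful actP) => v.
by rewrite cactB ab subrr.
Qed.

(* Multiply the linearization act (d v) w + act (d w) v = 0 by d v. *)
Lemma cact_self_eq0_sqr (d : V -> A) :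
    {morph d : u v / u + v} -> (forall u v, d u * d v = d v * d u) ->
    (forall v, act (d v) v = 0) ->
  forall v, d v * d v = 0.
Proof.
move=> dD dC dv v; apply: (cact_faithful actP) => w.
rewrite (cactM actP) //.
have lin : act (d v) w + act (d w) v = 0.
  by move: (dv (v + w)); rewrite dD (cactDr actP) !(cactDl actP) !dv add0r addr0 addrC.
transitivity (act (d v) (act (d v) w + act (d w) v)); last by rewrite lin cact0r.
rewrite (cactDr actP) -[X in _ + X](cactM actP) // dC (cactM actP) // dv cact0r.
by rewrite addr0.
Qed.

(** At a = 1 the identity gives G v = 2 (F 1 v) v, so d a v = F a v - a * F 1 v annihilates v and
    hence squares to zero. By properness d a v = g v a - g v 1 * a, which is a square-zero family as
    in [square_zero_central_family]; this forces g = 0. *)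
Lemma quadratic_corner_identity (F : A -> V -> A) (G : V -> V) :
    (forall v, {morph F^~ v : a b / a + b}) ->
    (forall a, {morph F a : u v / u + v}) ->
    (forall v, exists (c : A) (g : A -> A),
       [/\ center A c, forall a, center A (g a) & forall a, F a v = c * a + g a]) ->
    (forall a v, act (F a v) v + act (F a v) v = act a (G v)) ->
  [/\ forall v, center A (F 1 v), forall a v, F a v = F 1 v * a &
      forall v, G v = act (F 1 v) v + act (F 1 v) v].
Proof.
move=> FDl FDr Fproper FG.
pose d a v := F a v - a * F 1 v.
have [c /choice[g cgP]] := choice Fproper.
have cc v : center A (c v) by case: (cgP v).
have cg v a : center A (g v a) by case: (cgP v).
have FE a v : F a v = c v * a + g v a by case: (cgP v).
have dE a v : d a v = g v a - g v 1 * a.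
  rewrite /d !FE; have cv := cc v; have cgv := cg v 1.
  by ncring [:: c v; g v 1].
have d_self a v : act (d a v) v = 0.
  have F1C : a * F 1 v = F 1 v * a.
    by rewrite FE; have cv := cc v; have cgv := cg v 1; ncring [:: c v; g v 1].
  apply: (double_eq0 half_R); rewrite /d cactB addrACA FG -opprD.
  by rewrite (cactM actP) // -(cactDr actP) FG (cact1 actP) subrr.
have d_sqr a v : d a v * d a v = 0.
  apply: (@cact_self_eq0_sqr (d a)) => // [u w|u w].
    by rewrite /d FDr FDr; ncring (@nil A).
  rewrite !dE; have cu := cg u a; have cw := cg w a.
  have cu1 := cg u 1; have cw1 := cg w 1.
  by ncring [:: g u a; g w a; g u 1; g w 1].
have g0 v : forall a, g v a = 0.
  have dD : {morph d^~ v : a b / a + b}.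
    by move=> a b; rewrite /d FDl; ncring (@nil A).
  by have [] := square_zero_central_family torsionA noncentral dD
    (d_sqr^~ v) (cg v 1) (cg v) (dE^~ v).
have FcE a v : F a v = c v * a by rewrite FE g0 addr0.
split=> [v|a v|v]; first by rewrite FcE mulr1.
  by rewrite !FcE mulr1.
by rewrite FG (cact1 actP).
Qed.

(** Putting c = 1 expresses g a through F a 1 and g 1, and g 1 is half the action of F 1 1. The
    latter is central, as one sees from [F a a, a] = 0 at a + 1; hence z = l - F 1 1 / 2. The
    diagonal of the identity then determines F a a, and polarization gives F. *)
Lemma bilinear_corner_identity (F : A -> A -> A) (g : A -> V -> V) :
    (forall a c, F a c = F c a) ->
    (forall c, {morph F^~ c : a b / a + b}) ->
    (forall a, F a a * a = a * F a a) ->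
    (exists (l : A) (k : A -> A),
       [/\ center A l, forall a, center A (k a) & forall a, F a 1 = l * a + k a]) ->
    (forall a c v, act (F a c) v = act a (g c v) + act c (g a v)) ->
  exists (z : A) (k : A -> A),
    [/\ center A z, forall a, center A (k a),
        forall a v, g a v = act (z * a + k a) v &
        forall a c, F a c = z * (a * c + c * a) + k a * c + k c * a].
Proof.
move=> FC FDl FaC [l [k [cl ck FE]]] Fg.
case: half_R => h h2.
have FDr c a b : F c (a + b) = F c a + F c b by rewrite !(FC c) FDl.
have kD a b : k (a + b) = k a + k b.
  by apply: (addrI (l * (a + b))); rewrite -FE FDl !FE; ncring (@nil A).
have ce : center A (F 1 1).
  move=> a; have := FaC (a + 1); rewrite !FDl !FDr (FC 1) FE => eqC.
  apply/eqP; rewrite -subr_eq0; apply/eqP.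
  transitivity ((F a a + (l * a + k a) + (l * a + k a + F 1 1)) * (a + 1)
     - (a + 1) * (F a a + (l * a + k a) + (l * a + k a + F 1 1))
     - (F a a * a - a * F a a)).
    by have cka := ck a; ncring [:: l; k a].
  by rewrite eqC FaC !subrr.
have halfD (W : lmodType R) (w : W) : h *: w + h *: w = w.
  by rewrite -scalerDl -mulr2n h2 scale1r.
have g1E v : g 1 v = h *: act (F 1 1) v.
  by rewrite Fg !(cact1 actP) scalerDr halfD.
pose z := l - h *: F 1 1.
have cz : center A z by apply/centerB/centerZ.
have gE a v : g a v = act (z * a + k a) v.
  have -> : z * a + k a = F a 1 - h *: (a * F 1 1).
    by rewrite FE /z mulrBl -scalerAl ce addrAC.
  rewrite cactB (cactZl actP) (cactM actP) ?ce // -(cactZr actP) -g1E Fg.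
  by rewrite (cact1 actP) addrC addKr.
exists z, k; split=> // a c.
have FaaE b : F b b = b * (z * b + k b) + b * (z * b + k b).
  have bC : b * (z * b + k b) = (z * b + k b) * b.
    by have ckb := ck b; ncring [:: z; k b].
  by apply: cact_inj => v; rewrite (cactDl actP) (cactM actP _ bC) -gE Fg.
apply: (double_inj half_R).
transitivity (F (a + c) (a + c) - F a a - F c c).
  by rewrite !FDl !FDr (FC c a); ncring (@nil A).
rewrite !FaaE kD; have cka := ck a; have ckc := ck c.
by ncring [:: z; k a; k c].
Qed.

End CornerIdentities.

(** * The center of a triangular algebra *)

Section TriangularCenter.
Variables (R : comNzRingType) (A B : algType R) (M : bimodType A B).
Local Notation T := (triangular M).
Implicit Types (x y c : T) (a : A) (b : B) (m : M).

Definition inA a : T := Triangular a 0 0.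
Definition inM m : T := Triangular 0 m 0.
Definition inB b : T := Triangular 0 0 b.

Lemma tri_ext x y :
  pi_A x = pi_A y -> pi_M x = pi_M y -> pi_B x = pi_B y -> x = y.
Proof. by case: x y => [a m b] [a' m' b'] /= -> -> ->. Qed.

Lemma pi_AD x y : pi_A (x + y) = pi_A x + pi_A y. Proof. by []. Qed.
Lemma pi_MD x y : pi_M (x + y) = pi_M x + pi_M y. Proof. by []. Qed.
Lemma pi_BD x y : pi_B (x + y) = pi_B x + pi_B y. Proof. by []. Qed.
Lemma pi_AN x : pi_A (- x) = - pi_A x. Proof. by []. Qed.
Lemma pi_MN x : pi_M (- x) = - pi_M x. Proof. by []. Qed.
Lemma pi_BN x : pi_B (- x) = - pi_B x. Proof. by []. Qed.
Lemma pi_AM x y : pi_A (x * y) = pi_A x * pi_A y. Proof. by []. Qed.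
Lemma pi_MM x y : pi_M (x * y) = lact (pi_A x) (pi_M y) + ract (pi_M x) (pi_B y).
Proof. by []. Qed.
Lemma pi_BM x y : pi_B (x * y) = pi_B x * pi_B y. Proof. by []. Qed.

Definition pi_ring := (pi_AD, pi_MD, pi_BD, pi_AN, pi_MN, pi_BN, pi_AM, pi_MM, pi_BM).

Lemma lact0l m : lact (0 : A) m = 0.
Proof. exact: (@additive0 A M (fun a => lact a m) (fun a a' => lactDl a a' m)). Qed.

Lemma ract0r m : ract m (0 : B) = 0.
Proof. exact: (@additive0 B M (ract m) (ractDr m)). Qed.

Lemma lactNl a m : lact (- a) m = - lact a m.
Proof. exact: (@additiveN A M (fun a => lact a m) (fun a a' => lactDl a a' m)). Qed.

Lemma lactNr a m : lact a (- m) = - lact a m.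
Proof. exact: (@additiveN M M (lact a) (lactDr a)). Qed.

Lemma ractNr m b : ract m (- b) = - ract m b.
Proof. exact: (@additiveN B M (ract m) (ractDr m)). Qed.

Definition tri_zeros := (lact0l, ract0r, lact0, ract0, mul0r, mulr0, add0r, addr0,
  subr0, sub0r, oppr0).

Lemma inAD : {morph inA : a b / a + b}.
Proof. by move=> a b; apply: tri_ext; rewrite ?pi_ring //= addr0. Qed.

Lemma inMD : {morph inM : a b / a + b}.
Proof. by move=> a b; apply: tri_ext; rewrite ?pi_ring //= addr0. Qed.

Lemma inMN : {morph inM : a / - a}.
Proof. exact: additiveN inMD. Qed.

(* Additive identities in M are checked in the ring T, where ncring applies. *)
Lemma inM_inj : injective inM.
Proof. by move=> m n /(congr1 pi_M). Qed.

Lemma inBD : {morph inB : a b / a + b}.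
Proof. by move=> a b; apply: tri_ext; rewrite ?pi_ring //= addr0. Qed.

Lemma inAZ (k : R) a : inA (k *: a) = k *: inA a.
Proof. by apply: tri_ext; rewrite //= scaler0. Qed.

Lemma inBZ (k : R) b : inB (k *: b) = k *: inB b.
Proof. by apply: tri_ext; rewrite //= scaler0. Qed.

Lemma tri_decomp x : x = inA (pi_A x) + inM (pi_M x) + inB (pi_B x).
Proof. by apply: tri_ext; rewrite !pi_ring /= !tri_zeros. Qed.

Lemma center_piM c : center T c -> pi_M c = 0.
Proof.
by move=> /(_ (inA 1))/(congr1 pi_M); rewrite !pi_ring /= !tri_zeros lact1.
Qed.

Lemma center_lact c m : center T c -> lact (pi_A c) m = ract m (pi_B c).
Proof.
by move=> /(_ (inM m))/(congr1 pi_M); rewrite !pi_ring /= !tri_zeros.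
Qed.

Lemma center_piA c : center T c -> center A (pi_A c).
Proof. by move=> cc a; have /(congr1 pi_A) := cc (inA a). Qed.

Lemma center_piB c : center T c -> center B (pi_B c).
Proof. by move=> cc b; have /(congr1 pi_B) := cc (inB b). Qed.

Hypotheses (faithl : left_faithful M) (faithr : right_faithful M).

Lemma lact_inj a a' : (forall m, lact a m = lact a' m) -> a = a'.
Proof.
move=> eqa; apply/subr0_eq/faithl => m.
by rewrite lactDl lactNl eqa subrr.
Qed.

Lemma ract_inj b b' : (forall m, ract m b = ract m b') -> b = b'.
Proof.
move=> eqb; apply/subr0_eq/faithr => m.
by rewrite ractDr ractNr eqb subrr.
Qed.

(** Faithfulness turns the intertwining relation into centrality of the diagonal entries, because
    the left and right actions commute. *)
Lemma center_triP c : pi_M c = 0 ->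
  (forall m, lact (pi_A c) m = ract m (pi_B c)) -> center T c.
Proof.
move=> cM cAB x; apply: tri_ext; rewrite !pi_ring ?cM ?tri_zeros //.
- by apply: lact_inj => m; rewrite !lactA !cAB lractA.
by apply: ract_inj => m; rewrite !ractA -!cAB lractA.
Qed.

Lemma center_piA_eq0 c : center T c -> pi_A c = 0 -> c = 0.
Proof.
move=> cc cA; apply: tri_ext; rewrite ?(center_piM cc) //.
by apply: faithr => m; rewrite -center_lact // cA lact0l.
Qed.

Lemma center_piB_eq0 c : center T c -> pi_B c = 0 -> c = 0.
Proof.
move=> cc cB; apply: tri_ext; rewrite ?(center_piM cc) //.
by apply: faithl => m; rewrite center_lact // cB ract0r.
Qed.

Lemma corner_action_lact : corner_action (fun a (m : M) => lact a m).
Proof.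
split=> [||||||a /faithl //]; first exact: lactDl; first exact: lactDr.
- exact: lactZl.
- exact: lactZr.
- exact: lact1.
by move=> a b m _; rewrite lactA.
Qed.

Lemma corner_action_ract : corner_action (fun b (m : M) => ract m b).
Proof.
split=> [||||||b /faithr //].
- by move=> a b m; apply: ractDr.
- by move=> a b m; apply: ractDl.
- by move=> k a m; apply: ractZr.
- by move=> k a m; apply: ractZl.
- exact: ract1.
by move=> a b m ->; rewrite ractA.
Qed.

Hypothesis loyalM : loyal M.

(** Since a m (pi_B c) = (pi_A c) a m = 0 for all m, loyalty applies to a and pi_B c. *)
Lemma center_torsionA c a : center T c -> pi_A c * a = 0 -> c = 0 \/ a = 0.
Proof.
move=> cc ca; have [m|a0|cB] := @loyalM a (pi_B c).
- rewrite lractA -center_lact // -lactA.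
  by rewrite -(center_piA cc) ca lact0l.
- by right.
by left; apply: center_piB_eq0.
Qed.

Lemma center_torsionB c b : center T c -> pi_B c * b = 0 -> c = 0 \/ b = 0.
Proof.
move=> cc cb; have [m|cA|b0] := @loyalM (pi_A c) b.
- by rewrite center_lact // -ractA cb ract0r.
- by left; apply: center_piA_eq0.
by right.
Qed.

Lemma center_integral c d : center T c -> center T d -> c * d = 0 -> c = 0 \/ d = 0.
Proof.
move=> cc cd /(congr1 pi_A); rewrite pi_ring.
by case/(center_torsionA cc) => [c0|/(center_piA_eq0 cd) d0]; [left | right].
Qed.

Hypothesis centerA : pi_A @` center T = center A.
Hypothesis centerB : pi_B @` center T = center B.

Lemma center_lift_A a : center A a -> exists2 c, center T c & pi_A c = a.
Proof. by rewrite -centerA => -[c cc <-]; exists c. Qed.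

Lemma center_lift_B b : center B b -> exists2 c, center T c & pi_B c = b.
Proof. by rewrite -centerB => -[c cc <-]; exists c. Qed.

Lemma central_torsion_freeA : central_torsion_free A.
Proof.
move=> _ a /center_lift_A[c cc <-] /(center_torsionA cc)[->|a0]; [by left | by right].
Qed.

Lemma central_torsion_freeB : central_torsion_free B.
Proof.
move=> _ b /center_lift_B[c cc <-] /(center_torsionB cc)[->|b0]; [by left | by right].
Qed.

End TriangularCenter.

(** * Centralizing traces *)

(** Derives an equation from a known one, leaving a pure ring identity for [ncring]. *)
Lemma subr_eq_trans (V : zmodType) (x y a b : V) : a = b -> x - y = a - b -> x = y.
Proof. by move=> ->; rewrite subrr => /subr0_eq. Qed.

Lemma linear_bundle (R : comNzRingType) (U V : lmodType R) (f : U -> V) :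
  linear f -> exists F : {linear U -> V}, forall x, F x = f x.
Proof.
move=> flin; pose fL := GRing.isLinear.Build R U V *:%R f flin.
pose F : {linear U -> V} := HB.pack f fL.
by exists F.
Qed.

Section CentralizingTrace.
Variables (R : comNzRingType) (half_R : exists h : R, h *+ 2 = 1).
Variables (A B : algType R) (M : bimodType A B).
Local Notation T := (triangular M).
Hypotheses (faithl : left_faithful M) (faithr : right_faithful M).
Hypothesis loyalM : loyal M.
Hypothesis properA : forall f : {linear A -> A}, commuting f -> proper_map f.
Hypothesis properB : forall f : {linear B -> B}, commuting f -> proper_map f.
Hypothesis piA_center : pi_A @` center T = center A.
Hypothesis piB_center : pi_B @` center T = center B.
Hypothesis noncentralA : exists a : A, ~ center A a.
Hypothesis noncentralB : exists b : B, ~ center B b.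

Variable D : T -> T -> T.
Hypothesis DC : forall x y, D x y = D y x.
Hypothesis Dlin : forall y, linear (D^~ y).
Hypothesis D_cyclic : forall x y w,
  center T (comm_br (D x y) w + comm_br (D y w) x + comm_br (D w x) y).
Hypothesis D_diag : forall x, center T (comm_br (D x x) x).
Notation f x y := (pi_A (D x y)).
Notation g x y := (pi_M (D x y)).
Notation h x y := (pi_B (D x y)).
Notation iA := (inA M).
Notation iM := (@inM R A B M).
Notation iB := (inB M).
Implicit Types (a : A) (b : B) (m n : M).

Lemma properA_fun (p : A -> A) : linear p -> (forall a, p a * a = a * p a) ->
  exists (c : A) (k : A -> A),
    [/\ center A c, forall a, center A (k a) & forall a, p a = c * a + k a].
Proof.
move=> /linear_bundle[P PE] pC; have [|c [k [cc ck Pck]]] := @properA P.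
  by move=> a; rewrite PE /comm_br pC subrr.
by exists c, k; split=> // a; rewrite -PE.
Qed.

Lemma properB_fun (p : B -> B) : linear p -> (forall b, p b * b = b * p b) ->
  exists (c : B) (k : B -> B),
    [/\ center B c, forall b, center B (k b) & forall b, p b = c * b + k b].
Proof.
move=> /linear_bundle[P PE] pC; have [|c [k [cc ck Pck]]] := @properB P.
  by move=> b; rewrite PE /comm_br pC subrr.
by exists c, k; split=> // b; rewrite -PE.
Qed.

Lemma D_addl x y w : D (x + y) w = D x w + D y w.
Proof. by have := Dlin w 1 x y; rewrite !scale1r. Qed.

Lemma D_addr x y w : D w (x + y) = D w x + D w y.
Proof. by rewrite !(DC w) D_addl. Qed.

(** * M-components of the centrality conditions on [D] *)

Lemma D_MAA a a' m :
  lact (f (iA a) (iA a')) m - ract m (h (iA a) (iA a'))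
  = lact a (g (iA a') (iM m)) + lact a' (g (iA a) (iM m)).
Proof.
have := center_piM (D_cyclic (iA a) (iA a') (iM m)).
rewrite /comm_br !pi_ring /= !tri_zeros (DC (iM m)) -addrA -opprD => /eqP.
by rewrite subr_eq0 => /eqP.
Qed.

Lemma D_MBB b b' m :
  lact (f (iB b) (iB b')) m - ract m (h (iB b) (iB b'))
  = - (ract (g (iB b') (iM m)) b + ract (g (iB b) (iM m)) b').
Proof.
have := center_piM (D_cyclic (iB b) (iB b') (iM m)).
rewrite /comm_br !pi_ring /= !tri_zeros (DC (iM m)) -addrA => /eqP.
by rewrite addr_eq0 => /eqP.
Qed.

Lemma D_MAB a b m :
  lact (f (iA a) (iB b)) m - ract m (h (iA a) (iB b))
  = lact a (g (iB b) (iM m)) - ract (g (iA a) (iM m)) b.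
Proof.
have := center_piM (D_cyclic (iA a) (iB b) (iM m)).
rewrite /comm_br !pi_ring /= !tri_zeros (DC (iM m)) => /eqP.
rewrite addr_eq0 => /eqP.
by move/(canRL (subrK _)) => ->; rewrite addrC.
Qed.

Lemma D_MAM a m :
  lact (f (iA a) (iM m)) m - ract m (h (iA a) (iM m))
  + (lact (f (iA a) (iM m)) m - ract m (h (iA a) (iM m)))
  = lact a (g (iM m) (iM m)).
Proof.
have := center_piM (D_cyclic (iA a) (iM m) (iM m)).
rewrite /comm_br !pi_ring /= !tri_zeros (DC (iM m) (iA a)) => /eqP.
by rewrite addrAC subr_eq0 => /eqP.
Qed.

Lemma D_MBM b m :
  ract m (h (iB b) (iM m)) - lact (f (iB b) (iM m)) m
  + (ract m (h (iB b) (iM m)) - lact (f (iB b) (iM m)) m)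
  = ract (g (iM m) (iM m)) b.
Proof.
have := center_piM (D_cyclic (iB b) (iM m) (iM m)).
rewrite /comm_br !pi_ring /= !tri_zeros (DC (iM m) (iB b)) => /eqP.
rewrite addrAC addr_eq0 => /eqP eqD.
by rewrite -[RHS]opprK -eqD opprD opprB.
Qed.

(** The cyclic condition at three equal arguments would give only three times this, so the diagonal
    condition is used. *)
Lemma D_MMM m : lact (f (iM m) (iM m)) m = ract m (h (iM m) (iM m)).
Proof.
have := center_piM (D_diag (iM m)).
by rewrite /comm_br !pi_ring /= !tri_zeros => /subr0_eq.
Qed.

(** Bracketing with [iA 1] or [iB 1] isolates an M-component up to sign. The order of this and the
    next five lemmas matters: each removes the other M-terms from a later instance of the cyclic
    condition. *)
Lemma D_M_AA1 : g (iA 1) (iA 1) = 0.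
Proof.
have := center_piM (D_diag (iA 1)).
by rewrite /comm_br !pi_ring /= !tri_zeros lact1 => /eqP; rewrite oppr_eq0 => /eqP.
Qed.

Lemma D_M_A1B b : g (iA 1) (iB b) = 0.
Proof.
have := center_piM (D_cyclic (iA 1) (iA 1) (iB b)).
rewrite /comm_br !pi_ring /= !tri_zeros D_M_AA1 (DC (iB b)) !tri_zeros !lact1.
rewrite -opprD => /eqP; rewrite oppr_eq0 => /eqP; exact: (double_eq0 half_R).
Qed.

Lemma D_M_BB b b' : g (iB b) (iB b') = 0.
Proof.
have gbb b0 : g (iB b0) (iB b0) = 0.
  have := center_piM (D_cyclic (iB b0) (iB b0) (iA 1)).
  rewrite /comm_br !pi_ring /= !tri_zeros (DC (iB b0) (iA 1)) D_M_A1B !tri_zeros.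
  by rewrite lact1 => /eqP; rewrite oppr_eq0 => /eqP.
apply: (double_eq0 half_R).
have := gbb (b + b'); rewrite inBD D_addl !D_addr !pi_ring !gbb (DC (iB b')).
by rewrite !tri_zeros.
Qed.

Lemma D_M_AB1 a : g (iA a) (iB 1) = 0.
Proof.
have := center_piM (D_cyclic (iB 1) (iB 1) (iA a)).
rewrite /comm_br !pi_ring /= !tri_zeros D_M_BB (DC (iB 1)) !tri_zeros !ract1.
exact: (double_eq0 half_R).
Qed.

Lemma D_M_AA a a' : g (iA a) (iA a') = 0.
Proof.
have gaa a0 : g (iA a0) (iA a0) = 0.
  have := center_piM (D_cyclic (iA a0) (iA a0) (iB 1)).
  rewrite /comm_br !pi_ring /= !tri_zeros (DC (iB 1)) D_M_AB1 !tri_zeros.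
  by rewrite ract1.
apply: (double_eq0 half_R).
have := gaa (a + a'); rewrite inAD D_addl !D_addr !pi_ring !gaa (DC (iA a')).
by rewrite !tri_zeros.
Qed.

Lemma D_M_AB a b : g (iA a) (iB b) = 0.
Proof.
have := center_piM (D_cyclic (iA a) (iA 1) (iB b)).
rewrite /comm_br !pi_ring /= !tri_zeros D_M_AA D_M_A1B (DC (iB b)) !tri_zeros.
by rewrite lact1 => /eqP; rewrite oppr_eq0 => /eqP.
Qed.

(** * Commuting and central diagonal components of [D] *)

Lemma D_A_AA a : f (iA a) (iA a) * a = a * f (iA a) (iA a).
Proof.
apply/subr0_eq/faithl => m; have := center_lact m (D_diag (iA a)).
by rewrite /comm_br !pi_ring /= !tri_zeros.
Qed.

Lemma D_B_BB b : h (iB b) (iB b) * b = b * h (iB b) (iB b).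
Proof.
apply/subr0_eq/faithr => m; have := center_lact m (D_diag (iB b)).
by rewrite /comm_br !pi_ring /= !tri_zeros.
Qed.

Lemma D_A_AA1 a : f (iA a) (iA 1) * a = a * f (iA a) (iA 1).
Proof.
apply/subr0_eq/(double_eq0 half_R)/faithl => m.
have := center_lact m (D_cyclic (iA a) (iA a) (iA 1)).
by rewrite /comm_br !pi_ring /= !tri_zeros mulr1 mul1r subrr add0r (DC (iA 1)).
Qed.

Lemma D_B_BB1 b : h (iB b) (iB 1) * b = b * h (iB b) (iB 1).
Proof.
apply/subr0_eq/(double_eq0 half_R)/faithr => m.
have := center_lact m (D_cyclic (iB b) (iB b) (iB 1)).
by rewrite /comm_br !pi_ring /= !tri_zeros mulr1 mul1r subrr add0r (DC (iB 1)).
Qed.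

(** The cyclic sum at a, a, m has zero B-component: [iA a] has no B-entry, and a bracket with [iM m]
    has no diagonal. Being central, the sum then has zero A-component too. *)
Lemma D_A_AM a m : f (iA a) (iM m) * a = a * f (iA a) (iM m).
Proof.
apply/subr0_eq/(double_eq0 half_R)/faithl => n.
have := center_lact n (D_cyclic (iA a) (iA a) (iM m)).
by rewrite /comm_br !pi_ring /= !tri_zeros (DC (iM m)).
Qed.

Lemma D_B_BM b m : h (iB b) (iM m) * b = b * h (iB b) (iM m).
Proof.
apply/subr0_eq/(double_eq0 half_R)/faithr => n.
have := center_lact n (D_cyclic (iB b) (iB b) (iM m)).
by rewrite /comm_br !pi_ring /= !tri_zeros (DC (iM m)).
Qed.

Lemma D_A_MM m n : center A (f (iM m) (iM n)).
Proof.
move=> a; apply/subr0_eq/faithl => n'.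
have := center_lact n' (D_cyclic (iM m) (iM n) (iA a)).
by rewrite /comm_br !pi_ring /= !tri_zeros.
Qed.

Lemma D_B_MM m n : center B (h (iM m) (iM n)).
Proof.
move=> b; apply/subr0_eq/faithr => n'.
have := center_lact n' (D_cyclic (iM m) (iM n) (iB b)).
by rewrite /comm_br !pi_ring /= !tri_zeros.
Qed.

Let torsionA := central_torsion_freeA faithl loyalM piA_center.
Let torsionB := central_torsion_freeB faithr loyalM piB_center.

(** Here the B-component [h(a, m), b] of the cyclic sum may be nonzero, so [f(b, m), a] is at first
    only known to be central. *)
Lemma D_A_BM b m : center A (f (iB b) (iM m)).
Proof.
apply: (center_of_central_commutators half_R torsionA) => a.
have := center_piA (D_cyclic (iA a) (iB b) (iM m)).
by rewrite /comm_br !pi_ring /= !tri_zeros.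
Qed.

Lemma D_B_AM a m : center B (h (iA a) (iM m)).
Proof.
apply: (center_of_central_commutators half_R torsionB) => b.
have := center_piB (D_cyclic (iA a) (iB b) (iM m)).
by rewrite /comm_br !pi_ring /= !tri_zeros (DC (iM m)).
Qed.

(** The cyclic sum at a, a, b has B-component [h(a, a), b], so a priori the map is only centralizing
    in a. *)
Lemma D_A_AB a b : f (iA a) (iB b) * a = a * f (iA a) (iB b).
Proof.
have fD : {morph (fun a => f (iA a) (iB b)) : a a' / a + a'}.
  by move=> a1 a2; rewrite inAD D_addl.
apply: (centralizing_additive_commuting half_R torsionA fD) => a'.
have := center_piA (D_cyclic (iA a') (iA a') (iB b)).
rewrite /comm_br !pi_ring /= !tri_zeros (DC (iB b)) => c2 x.
by apply: (double_inj half_R); rewrite -mulrDl c2 mulrDr.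
Qed.

Lemma D_B_AB a b : h (iA a) (iB b) * b = b * h (iA a) (iB b).
Proof.
have hD : {morph (fun b => h (iA a) (iB b)) : b b' / b + b'}.
  by move=> b1 b2; rewrite inBD D_addr.
apply: (centralizing_additive_commuting half_R torsionB hD) => b'.
have := center_piB (D_cyclic (iB b') (iB b') (iA a)).
rewrite /comm_br !pi_ring /= !tri_zeros (DC (iB b')) => c2 x.
by apply: (double_inj half_R); rewrite -mulrDl c2 mulrDr.
Qed.

(** By [D_A_AB] the cyclic sum at a, a, b now has zero A-component, hence [h(a, a), b] vanishes as
    well; polarization does the rest. *)
Lemma D_B_AA a a' : center B (h (iA a) (iA a')).
Proof.
have haa a0 : center B (h (iA a0) (iA a0)).
  move=> b; apply/subr0_eq/faithr => m.
  have := center_lact m (D_cyclic (iA a0) (iA a0) (iB b)).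
  rewrite /comm_br !pi_ring /= !tri_zeros (DC (iB b)) D_A_AB subrr.
  by rewrite !tri_zeros => <-.
move=> x; apply: (double_inj half_R).
have := haa (a + a') x; rewrite inAD D_addl !D_addr !pi_ring (DC (iA a')).
rewrite !mulrDl !mulrDr !haa -!addrA => /addrI; rewrite !addrA => /addIr.
by [].
Qed.

Lemma D_A_BB b b' : center A (f (iB b) (iB b')).
Proof.
have haa b0 : center A (f (iB b0) (iB b0)).
  move=> a; apply/subr0_eq/faithl => m.
  have := center_lact m (D_cyclic (iB b0) (iB b0) (iA a)).
  rewrite /comm_br !pi_ring /= !tri_zeros (DC (iB b0)) D_B_AB subrr.
  by rewrite !tri_zeros.
move=> x; apply: (double_inj half_R).
have := haa (b + b') x; rewrite inBD D_addl !D_addr !pi_ring (DC (iB b')).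
rewrite !mulrDl !mulrDr !haa -!addrA => /addrI; rewrite !addrA => /addIr.
by [].
Qed.

(** On the center of B this is the isomorphism of centers induced by the center of T; off the center
    the values of [s] are unspecified. *)
Lemma center_transfer_BA : exists s : B -> A, forall b, center B b ->
  center A (s b) /\ forall m, lact (s b) m = ract m b.
Proof.
have /choice[s sP] : forall b, exists a, center B b ->
    center A a /\ forall m, lact a m = ract m b.
  move=> b; have [cb|ncb] := pselect (center B b); last by exists 0.
  have [c cc <-] := center_lift_B piB_center cb; exists (pi_A c) => _.
  by split=> [|m]; [apply: center_piA | apply: center_lact].
by exists s.
Qed.

Lemma center_transfer_AB : exists s : A -> B, forall a, center A a ->
  center B (s a) /\ forall m, ract m (s a) = lact a m.
Proof.
have /choice[s sP] : forall a, exists b, center A a ->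
    center B b /\ forall m, ract m b = lact a m.
  move=> a; have [ca|nca] := pselect (center A a); last by exists 0.
  have [c cc <-] := center_lift_A piA_center ca; exists (pi_B c) => _.
  by split=> [|m]; [apply: center_piB | rewrite center_lact].
by exists s.
Qed.

(** * Shape of [D] on each pair of corners *)

Lemma D_AM_mu : exists c : M -> T,
  [/\ {morph c : m n / m + n}, forall m, center T (c m),
      forall a m n, lact (f (iA a) (iM m)) n =
        lact (pi_A (c m) * a) n + ract n (h (iA a) (iM m)) &
      forall m, g (iM m) (iM m) = lact (pi_A (c m)) m + lact (pi_A (c m)) m].
Proof.
have [s sP] := center_transfer_BA.
have actP := corner_action_lact faithl.
(* The value of h is central here, so it can be moved into A, and [D_MAM] becomes an identity for
   the action of A alone. *)
pose F a m := f (iA a) (iM m) - s (h (iA a) (iM m)).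
have sh a m n : lact (s (h (iA a) (iM m))) n = ract n (h (iA a) (iM m)).
  by case: (sP _ (D_B_AM a m)).
have sD b b' : center B b -> center B b' -> s (b + b') = s b + s b'.
  move=> cb cb'; apply: (lact_inj faithl) => m; rewrite lactDl.
  have [_ ->] := sP _ (centerD cb cb'); rewrite ractDr.
  by have [_ ->] := sP _ cb; have [_ ->] := sP _ cb'.
have FDl m : {morph F^~ m : a b / a + b}.
  move=> a a'; rewrite /F inAD D_addl !pi_ring sD; try exact: D_B_AM.
  by rewrite opprD addrACA.
have FDr a : {morph F a : m n / m + n}.
  move=> m n; rewrite /F inMD D_addr !pi_ring sD; try exact: D_B_AM.
  by rewrite opprD addrACA.
have Fproper m : exists (c : A) (k : A -> A),
   [/\ center A c, forall a, center A (k a) & forall a, F a m = c * a + k a].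
  have [||c [k [cc ck kE]]] := @properA_fun (fun a => f (iA a) (iM m)).
  - by move=> k a a'; rewrite inAD inAZ Dlin.
  - by move=> a; apply: D_A_AM.
  exists c, (fun a => k a - s (h (iA a) (iM m))); split=> // [a|a].
    by apply: centerB => //; case: (sP _ (D_B_AM a m)).
  by rewrite /F kE addrA.
have [|cF FE GE] := quadratic_corner_identity half_R torsionA noncentralA actP
  (G := fun m => g (iM m) (iM m)) FDl FDr Fproper.
  by move=> a m; rewrite (cactB actP) sh D_MAM.
have /choice[c cP] : forall m, exists c, center T c /\ pi_A c = F 1 m.
  by move=> m; have [c cc <-] := center_lift_A piA_center (cF m); exists c.
have cc m : center T (c m) by case: (cP m).
have cE m : pi_A (c m) = F 1 m by case: (cP m).
exists c; split=> // [m n|a m n|m].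
- apply/subr0_eq/(center_piA_eq0 faithr).
    by apply: centerB => //; apply: centerD.
  by rewrite !pi_ring !cE FDr subrr.
- by rewrite cE -FE -sh -lactDl subrK.
by rewrite cE GE.
Qed.

Lemma D_BM_mu : exists c : M -> T,
  [/\ {morph c : m n / m + n}, forall m, center T (c m),
      forall b m n, ract n (h (iB b) (iM m)) =
        ract n (pi_B (c m) * b) + lact (f (iB b) (iM m)) n &
      forall m, g (iM m) (iM m) = ract m (pi_B (c m)) + ract m (pi_B (c m))].
Proof.
have [s sP] := center_transfer_AB.
have actP := corner_action_ract faithr.
pose F b m := h (iB b) (iM m) - s (f (iB b) (iM m)).
have sf b m n : ract n (s (f (iB b) (iM m))) = lact (f (iB b) (iM m)) n.
  by case: (sP _ (D_A_BM b m)).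
have sD a a' : center A a -> center A a' -> s (a + a') = s a + s a'.
  move=> ca ca'; apply: (ract_inj faithr) => m; rewrite ractDr.
  have [_ ->] := sP _ (centerD ca ca'); rewrite lactDl.
  by have [_ ->] := sP _ ca; have [_ ->] := sP _ ca'.
have FDl m : {morph F^~ m : a b / a + b}.
  move=> b b'; rewrite /F inBD D_addl !pi_ring sD; try exact: D_A_BM.
  by rewrite opprD addrACA.
have FDr b : {morph F b : m n / m + n}.
  move=> m n; rewrite /F inMD D_addr !pi_ring sD; try exact: D_A_BM.
  by rewrite opprD addrACA.
have Fproper m : exists (c : B) (k : B -> B),
   [/\ center B c, forall b, center B (k b) & forall b, F b m = c * b + k b].
  have [||c [k [cc ck kE]]] := @properB_fun (fun b => h (iB b) (iM m)).
  - by move=> k b b'; rewrite inBD inBZ Dlin.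
  - by move=> b; apply: D_B_BM.
  exists c, (fun b => k b - s (f (iB b) (iM m))); split=> // [b|b].
    by apply: centerB => //; case: (sP _ (D_A_BM b m)).
  by rewrite /F kE addrA.
have [|cF FE GE] := quadratic_corner_identity half_R torsionB noncentralB actP
  (G := fun m => g (iM m) (iM m)) FDl FDr Fproper.
  by move=> b m; rewrite (cactB actP) sf D_MBM.
have /choice[c cP] : forall m, exists c, center T c /\ pi_B c = F 1 m.
  by move=> m; have [c cc <-] := center_lift_B piB_center (cF m); exists c.
have cc m : center T (c m) by case: (cP m).
have cE m : pi_B (c m) = F 1 m by case: (cP m).
exists c; split=> // [m n|b m n|m].
- apply/subr0_eq/(center_piB_eq0 faithl).
    by apply: centerB => //; apply: centerD.
  by rewrite !pi_ring !cE FDr subrr.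
- by rewrite cE -FE -sf -ractDr subrK.
by rewrite cE GE.
Qed.
(** The coefficients c and c' obtained from the two sides both compute g(m, m), so c m - c' m
    annihilates m; it therefore squares to zero and vanishes. *)
Lemma D_M_mu : exists c : M -> T,
  [/\ forall m, center T (c m),
      forall a m n, lact (f (iA a) (iM m)) n =
        lact (pi_A (c m) * a) n + ract n (h (iA a) (iM m)),
      forall b m n, ract n (h (iB b) (iM m)) =
        ract n (pi_B (c m) * b) + lact (f (iB b) (iM m)) n &
      forall m n, g (iM m) (iM n) = lact (pi_A (c m)) n + lact (pi_A (c n)) m].
Proof.
have [c [cD cc cA cMM]] := D_AM_mu; have [c' [c'D cc' cB c'MM]] := D_BM_mu.
have c'E m : c m = c' m.
  apply/subr0_eq/(center_piA_eq0 faithr); first exact: centerB.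
  apply: (central_sqr_eq0 torsionA); first exact/center_piA/centerB.
  move: m; apply: (cact_self_eq0_sqr (corner_action_lact faithl)).
  - by move=> m n; rewrite cD c'D !pi_ring opprD addrACA.
  - move=> m n; apply: center_piA; exact: centerB.
  move=> m; apply: (double_eq0 half_R).
  rewrite !pi_ring lactDl lactNl addrACA -cMM -opprD [X in - (X + _)]center_lact //.
  by rewrite [X in - (_ + X)]center_lact // -c'MM subrr.
exists c; split=> // [b m n|m n]; first by rewrite c'E.
apply: (double_inj half_R).
have := cMM (m + n); rewrite inMD D_addl !D_addr !pi_ring !cMM cD pi_ring.
rewrite !lactDl !lactDr (DC (iM n)).
set zm := lact _ m; set zn := lact (pi_A (c n)) n => eq_mn.
apply: (addrI (zm + zm + (zn + zn))).
by apply: inM_inj; move/(congr1 iM): eq_mn; rewrite !inMD => eq_mn;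
  transitivity (iM zm + iM zm + iM (g (iM m) (iM n)) +
    (iM (g (iM m) (iM n)) + (iM zn + iM zn))); [|rewrite eq_mn]; ncring (@nil T).
Qed.

Lemma D_AA_mu : exists (z : T) (k : A -> T),
  [/\ center T z, forall a, center T (k a),
      forall a m, g (iA a) (iM m) = lact (pi_A z * a + pi_A (k a)) m &
      forall a a' m, lact (f (iA a) (iA a')) m =
        lact (pi_A z * (a * a' + a' * a) + pi_A (k a) * a' + pi_A (k a') * a) m
        + ract m (h (iA a) (iA a'))].
Proof.
have [s sP] := center_transfer_BA.
have actP := corner_action_lact faithl.
pose F a a' := f (iA a) (iA a') - s (h (iA a) (iA a')).
have sh a a' m : lact (s (h (iA a) (iA a'))) m = ract m (h (iA a) (iA a')).
  by case: (sP _ (D_B_AA a a')).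
have cs a a' : center A (s (h (iA a) (iA a'))) by case: (sP _ (D_B_AA a a')).
have FC a a' : F a a' = F a' a by rewrite /F (DC (iA a)).
have FDl a' : {morph F^~ a' : a b / a + b}.
  move=> a b; apply: (lact_inj faithl) => m.
  rewrite lactDl /F !(cactB actP) !sh inAD D_addl !pi_ring lactDl ractDr.
  by rewrite opprD addrACA.
have FaC a : F a a * a = a * F a a by rewrite /F mulrBl mulrBr cs D_A_AA.
have [||l [p [cl cp pE]]] := @properA_fun (fun a => f (iA a) (iA 1)).
- by move=> x a a'; rewrite inAD inAZ Dlin.
- by move=> a; apply: D_A_AA1.
have [||z [k [cz ck gE FE]]] := bilinear_corner_identity half_R actP
    (g := fun a m => g (iA a) (iM m)) FC FDl FaC.
- exists l, (fun a => p a - s (h (iA a) (iA 1))); split=> // [a|a].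
    exact: centerB.
  by rewrite /F pE addrA.
- by move=> a a' m; rewrite (cactB actP) sh D_MAA.
have [w cw wE] := center_lift_A piA_center cz.
have /choice[q qP] : forall a, exists c, center T c /\ pi_A c = k a.
  by move=> a; have [c cc <-] := center_lift_A piA_center (ck a); exists c.
have qE a : pi_A (q a) = k a by case: (qP a).
exists w, q; split=> // [a|a m|a a' m]; first by case: (qP a).
  by rewrite gE wE qE.
by rewrite wE !qE -FE /F (cactB actP) sh subrK.
Qed.

Lemma D_BB_mu : exists (z : T) (k : B -> T),
  [/\ center T z, forall b, center T (k b),
      forall b m, g (iB b) (iM m) = ract m (pi_B z * b + pi_B (k b)) &
      forall b b' m, ract m (h (iB b) (iB b')) =
        ract m (pi_B z * (b * b' + b' * b) + pi_B (k b) * b' + pi_B (k b') * b)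
        + lact (f (iB b) (iB b')) m].
Proof.
have [s sP] := center_transfer_AB.
have actP := corner_action_ract faithr.
pose F b b' := h (iB b) (iB b') - s (f (iB b) (iB b')).
have sf b b' m : ract m (s (f (iB b) (iB b'))) = lact (f (iB b) (iB b')) m.
  by case: (sP _ (D_A_BB b b')).
have cs b b' : center B (s (f (iB b) (iB b'))) by case: (sP _ (D_A_BB b b')).
have FC b b' : F b b' = F b' b by rewrite /F (DC (iB b)).
have FDl b' : {morph F^~ b' : a b / a + b}.
  move=> a b; apply: (ract_inj faithr) => m.
  rewrite ractDr /F !(cactB actP) !sf inBD D_addl !pi_ring lactDl ractDr.
  by rewrite opprD addrACA.
have FbC b : F b b * b = b * F b b by rewrite /F mulrBl mulrBr cs D_B_BB.
have [||l [p [cl cp pE]]] := @properB_fun (fun b => h (iB b) (iB 1)).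
- by move=> x b b'; rewrite inBD inBZ Dlin.
- by move=> b; apply: D_B_BB1.
have [||z [k [cz ck gE FE]]] := bilinear_corner_identity half_R actP
    (g := fun b m => g (iB b) (iM m)) FC FDl FbC.
- exists l, (fun b => p b - s (f (iB b) (iB 1))); split=> // [b|b].
    exact: centerB.
  by rewrite /F pE addrA.
- move=> b b' m; rewrite (cactB actP) sf; apply/oppr_inj.
  by rewrite opprB D_MBB.
have [w cw wE] := center_lift_B piB_center cz.
have /choice[q qP] : forall b, exists c, center T c /\ pi_B c = k b.
  by move=> b; have [c cc <-] := center_lift_B piB_center (ck b); exists c.
have qE b : pi_B (q b) = k b by case: (qP b).
exists w, q; split=> // [b|b m|b b' m]; first by case: (qP b).
  by rewrite gE wE qE.
by rewrite wE !qE -FE /F (cactB actP) sf subrK.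
Qed.

(** For fixed b the map f(a, b) is proper in a, and for fixed a the map h(a, b) is proper in b.
    Subtracting the expected coefficients leaves central defects u, v, k and w = zB - zA with u(b) a
    m + k(a, b) m = v(a) m b + w a m b. Noncommutativity of the corners and loyalty make them vanish
    one after another. *)
Lemma proper_AB (zA zB : T) (kA : A -> T) (kB : B -> T) :
    center T zA -> center T zB ->
    (forall a, center T (kA a)) -> (forall b, center T (kB b)) ->
    (forall a m, g (iA a) (iM m) = lact (pi_A zA * a + pi_A (kA a)) m) ->
    (forall b m, g (iB b) (iM m) = ract m (pi_B zB * b + pi_B (kB b))) ->
  zA = zB /\
  forall a b m, lact (f (iA a) (iB b)) m + ract m (pi_B (kA a) * b)
              = ract m (h (iA a) (iB b)) + lact (pi_A (kB b) * a) m.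
Proof.
move=> czA czB ckA ckB gA gB.
have iM_lact a m : iM (lact a m) = iA a * iM m.
  by apply: tri_ext; rewrite !pi_ring /= !tri_zeros.
have iM_ract b m : iM (ract m b) = iM m * iB b.
  by apply: tri_ext; rewrite !pi_ring /= !tri_zeros.
have iA_cM c a m : center T c -> iA (pi_A c * a) * iM m = c * iA a * iM m.
  by move=> cc; apply: tri_ext; rewrite !pi_ring /= !tri_zeros.
have iB_cM c b m : center T c -> iM m * iB (pi_B c * b) = c * iM m * iB b.
  move=> cc; apply: tri_ext; rewrite !pi_ring /= !tri_zeros //.
  by rewrite center_lact // ractA.
have iA_c c m : center T c -> iA (pi_A c) * iM m = c * iM m.
  by move=> cc; apply: tri_ext; rewrite !pi_ring /= !tri_zeros.
have iB_c c m : center T c -> iM m * iB (pi_B c) = c * iM m.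
  move=> cc; apply: tri_ext; rewrite !pi_ring /= !tri_zeros //.
  by rewrite center_lact.
have fP b : exists c : T * (A -> T), [/\ center T c.1, forall a, center T (c.2 a) &
    forall a, f (iA a) (iB b) = pi_A c.1 * a + pi_A (c.2 a)].
  have [||c [k [cc ck kE]]] := @properA_fun (fun a => f (iA a) (iB b)).
  - by move=> x a a'; rewrite inAD inAZ Dlin.
  - by move=> a; apply: D_A_AB.
  have [w cw wE] := center_lift_A piA_center cc.
  have /choice[q qP] : forall a, exists c, center T c /\ pi_A c = k a.
    by move=> a; have [d cd <-] := center_lift_A piA_center (ck a); exists d.
  exists (w, q); split=> //= a; first by case: (qP a).
  by rewrite kE wE; case: (qP a) => _ ->.
have hP a : exists c : T * (B -> T), [/\ center T c.1, forall b, center T (c.2 b) &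
    forall b, h (iA a) (iB b) = pi_B c.1 * b + pi_B (c.2 b)].
  have [||c [k [cc ck kE]]] := @properB_fun (fun b => h (iA a) (iB b)).
  - by move=> x b b'; rewrite inBD inBZ !(DC (iA a)) Dlin.
  - by move=> b; apply: D_B_AB.
  have [w cw wE] := center_lift_B piB_center cc.
  have /choice[q qP] : forall b, exists c, center T c /\ pi_B c = k b.
    by move=> b; have [d cd <-] := center_lift_B piB_center (ck b); exists d.
  exists (w, q); split=> //= b; first by case: (qP b).
  by rewrite kE wE; case: (qP b) => _ ->.
have {fP} [F FP] := choice fP; have {hP} [H HP] := choice hP.
pose u b := (F b).1 - kB b; pose v a := (H a).1 - kA a.
pose k a b := (F b).2 a - (H a).2 b; pose w := zB - zA.
have cw : center T w by apply: centerB.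
have cu b : center T (u b) by apply: centerB => //; case: (FP b).
have cv a : center T (v a) by apply: centerB => //; case: (HP a).
have ck a b : center T (k a b).
  by apply: centerB; [case: (FP b) | case: (HP a)].
have key a b m : u b * iA a * iM m + k a b * iM m
    = v a * iM m * iB b + w * iA a * iM m * iB b.
  have [cF1 cF2 FE] := FP b; have [cH1 cH2 HE] := HP a.
  move/(congr1 iM): (D_MAB a b m); rewrite gA gB FE HE.
  rewrite !(inMD, inMN, iM_lact, iM_ract, inAD, inBD, mulrDl, mulrDr).
  rewrite !(iA_cM, iB_cM, iA_c, iB_c) // !mulrA => /subr_eq_trans; apply.
  have cka := ckA a; have ckb := ckB b; have cFa := cF2 a; have cHb := cH2 b.
  by rewrite /u /v /k /w; ncring
    [:: zA; zB; kA a; kB b; (F b).1; (F b).2 a; (H a).1; (H a).2 b].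
have iAM a a' : iA (a * a') = iA a * iA a'.
  by apply: tri_ext; rewrite !pi_ring /= ?tri_zeros.
have iBM b b' : iB (b * b') = iB b * iB b'.
  by apply: tri_ext; rewrite !pi_ring /= ?tri_zeros.
have iAN a : iA (- a) = - iA a by exact: (additiveN (@inAD R A B M)).
have iBN b : iB (- b) = - iB b by exact: (additiveN (@inBD R A B M)).
(* Comparing [key] at a1 m with a1 times [key] at m removes k and v and leaves [a0, a1] m (u(b) - w
   b) = 0. *)
have uw b : pi_B (u b) = pi_B w * b.
  have [a0 /not_centerP[a1 ncomm]] := noncentralA.
  have [m|//|/subr0_eq //] :=
    @loyalM (a0 * a1 - a1 * a0) (pi_B (u b) - pi_B w * b).
  apply: inM_inj; rewrite iM_ract iM_lact inBD iBN mulrDr mulrN -!mulrA.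
  rewrite iB_c // iB_cM // inAD iAN !iAM.
  have key1 := key a0 b (lact a1 m); rewrite !iM_lact in key1.
  have key2 := congr1 (fun x => iA a1 * x) (key a0 b m).
  rewrite /= in key2; have cub := cu b; have ckab := ck a0 b; have cva := cv a0.
  apply: subr_eq_trans (congr2 (fun x y => x - y) key1 key2) _.
  have -> : iM 0 = 0 by [].
  by ncring [:: u b; w; k a0 b; v a0].
have w0 : w = 0.
  have [b0 ncb0] := noncentralB; apply: (center_piB_eq0 faithl) => //.
  have cwb0 : center B (pi_B w * b0) by rewrite -uw; apply: center_piB.
  by case: (central_mul_central torsionB (center_piB cw) cwb0) => // /ncb0.
have u0 b : u b = 0.
  by apply: (center_piB_eq0 faithl) => //; rewrite uw w0 mul0r.
have {}key a b m : k a b * iM m = v a * iM m * iB b.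
  by have := key a b m; rewrite u0 w0 !mul0r add0r addr0.
have v0 a : v a = 0.
  have [b0 /not_centerP[b1 ncomm]] := noncentralB.
  apply: (center_piA_eq0 faithr) => //.
  have [m|//|//] := @loyalM (pi_A (v a)) (b0 * b1 - b1 * b0).
  apply: inM_inj; rewrite iM_ract iM_lact iA_c // inBD iBN !iBM.
  have key1 := key a b0 (ract m b1); rewrite !iM_ract in key1.
  have key2 := congr1 (fun x => x * iB b1) (key a b0 m).
  rewrite /= in key2; have ckab := ck a b0; have cva := cv a.
  apply: subr_eq_trans (congr2 (fun x y => x - y) key1 key2) _.
  have -> : iM 0 = 0 by [].
  by ncring [:: k a b0; v a].
have k0 a b : k a b = 0.
  apply: (center_piA_eq0 faithr) => //; apply: faithl => m.
  by apply: inM_inj; rewrite iM_lact iA_c // key v0 !mul0r.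
split=> [|a b m]; first by rewrite (subr0_eq (w0 : zB - zA = 0)).
have [_ _ FE] := FP b; have [_ cH HE] := HP a.
rewrite FE HE lactDl ractDr (subr0_eq (u0 b : _ - _ = 0)) (subr0_eq (v0 a : _ - _ = 0)).
rewrite (subr0_eq (k0 a b : _ - _ = 0)) center_lact; last exact: cH.
by rewrite addrC [X in _ + X]addrC addrA.
Qed.

(** The defect e is central, symmetric and biadditive with e(p, p) p = 0. The part of this linear in
    q, namely e(p, p) q + 2 e(p, q) p = 0, multiplied by e(p, p), yields e(p, p)^2 q = 0. *)
Lemma D_MM_central m n n' :
  lact (f (iM m) (iM n)) n' = ract n' (h (iM m) (iM n)).
Proof.
have [s sP] := center_transfer_BA.
pose e m n := f (iM m) (iM n) - s (h (iM m) (iM n)).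
have sh p q (r : M) : lact (s (h (iM p) (iM q))) r = ract r (h (iM p) (iM q)).
  by case: (sP _ (D_B_MM p q)).
have ce p q : center A (e p q).
  by apply: centerB; [apply: D_A_MM | case: (sP _ (D_B_MM p q))].
have eE p q (r : M) : lact (e p q) r
    = lact (f (iM p) (iM q)) r - ract r (h (iM p) (iM q)).
  by rewrite lactDl lactNl sh.
have eC p q : e p q = e q p by rewrite /e (DC (iM p)).
have eD p p' q : e (p + p') q = e p q + e p' q.
  apply: (lact_inj faithl) => r; rewrite lactDl !eE inMD D_addl !pi_ring.
  by rewrite lactDl ractDr opprD addrACA.
have eN p q : e (- p) q = - e p q.
  exact: (@additiveN M A (e^~ q) (fun x y => eD x y q)).
have epp p : lact (e p p) p = 0 by rewrite eE D_MMM subrr.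
clearbody e.
have e_lin p q : lact (e p p) q + (lact (e p q) p + lact (e p q) p) = 0.
  (* Subtracting the instances at p + q and p - q keeps twice the terms odd in q, so only division
     by 2 occurs. *)
  apply: (double_eq0 half_R); apply: inM_inj.
  have /= := congr2 (fun x y => iM x - iM y) (epp (p + q)) (epp (p - q)).
  rewrite !eD !(eC _ (_ + _)) !eD !eN !(eC _ (- q)) !eN (eC q p).
  rewrite !(lactDl, lactDr, lactNl, lactNr) !epp !(inMD, inMN) => eq_pq.
  have iM0 : iM 0 = 0 by [].
  by apply: subr_eq_trans eq_pq _; rewrite !iM0; ncring (@nil T).
have e0 p : e p p = 0.
  apply: (central_sqr_eq0 torsionA) => //; apply: faithl => q; rewrite lactA.
  have := congr1 (lact (e p p)) (e_lin p q).
  by rewrite !lactDr -(lactA _ (e p q)) (ce p p (e p q)) lactA epp !lact0 !addr0.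
have eeq0 p q : e p q = 0.
  apply: (double_eq0 half_R); have := e0 (p + q).
  by rewrite eD !(eC _ (p + q)) !eD !e0 (eC q p) add0r addr0.
by apply/subr0_eq; rewrite -eE eeq0 lact0l.
Qed.

Lemma centralizing_trace_proper : exists (z : T) (mu : T -> T),
  [/\ center T z, forall x, center T (mu x) &
      forall x y, center T (D x y - z * (x * y + y * x) - mu x * y - mu y * x)].
Proof.
have [c [cc cA cB cM]] := D_M_mu.
have [z [kA [cz ckA gA fA]]] := D_AA_mu.
have [zB [kB [czB ckB gB hB]]] := D_BB_mu.
have [zE fAB] := proper_AB cz czB ckA ckB gA gB.
pose mu x := kA (pi_A x) + c (pi_M x) + kB (pi_B x).
have muE x : mu x = kA (pi_A x) + c (pi_M x) + kB (pi_B x) by [].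
(* The values of [mu] are independent arguments, so [N] is biadditive in pairs and splits over the
   three corners without additivity of [kA], [c] or [kB]. *)
pose N x k y k' := D x y - z * (x * y + y * x) - k * y - k' * x.
have NE x k y k' : D x y - z * (x * y + y * x) - k * y - k' * x = N x k y k' by [].
have NC x k y k' : N x k y k' = N y k' x k.
  by rewrite /N (DC x); ncring (@nil T).
have NDl x x' k k' y ky : N (x + x') (k + k') y ky = N x k y ky + N x' k' y ky.
  by rewrite /N D_addl; ncring (@nil T).
have NDr x x' k k' y ky : N y ky (x + x') (k + k') = N y ky x k + N y ky x' k'.
  by rewrite !(NC y) NDl.
have cM0 := (center_piM cz, fun a => center_piM (ckA a), fun b => center_piM (ckB b),
  fun m => center_piM (cc m)).
have NAA a a' : center T (N (iA a) (kA a) (iA a') (kA a')).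
  apply: center_triP => // [|m]; rewrite !pi_ring /= ?cM0 !tri_zeros ?D_M_AA //.
  by rewrite -!addrA -!opprD lactDl lactNl fA !addrA [LHS]addrC addKr.
have NBB b b' : center T (N (iB b) (kB b) (iB b') (kB b')).
  apply: center_triP => // [|m]; rewrite !pi_ring /= ?cM0 !tri_zeros ?D_M_BB //.
  by rewrite -!addrA -!opprD ractDr ractNr zE hB !addrA [RHS]addrC addKr.
have NAB a b : center T (N (iA a) (kA a) (iB b) (kB b)).
  apply: center_triP => // [|m]; rewrite !pi_ring /= ?cM0 !tri_zeros ?D_M_AB //.
  rewrite lactDl lactNl ractDr ractNr.
  by apply: (canLR (addrK _)); rewrite addrAC -fAB addrK.
have NAM a m : center T (N (iA a) (kA a) (iM m) (c m)).
  apply: center_triP => // [|n]; rewrite !pi_ring /= ?cM0 !tri_zeros.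
    by rewrite gA lactDl -lactA addrAC addrK subrr.
  by rewrite lactDl lactNl cA [LHS]addrC addKr.
have NBM b m : center T (N (iB b) (kB b) (iM m) (c m)).
  apply: center_triP => // [|n]; rewrite !pi_ring /= ?cM0 !tri_zeros.
    rewrite gB ractDr -zE [X in X - _ - _]addrC.
    by rewrite -lractA !center_lact // ractA addrK subrr.
  by rewrite ractDr ractNr cB [RHS]addrC addKr.
have NMM m n : center T (N (iM m) (c m) (iM n) (c n)).
  apply: center_triP => // [|n']; rewrite !pi_ring /= ?cM0 !tri_zeros.
    by rewrite cM addrAC addrK subrr.
  by rewrite D_MM_central.
exists z, mu; split=> // [x|x y]; first by do ?apply: centerD.
rewrite NE; clearbody N; case: x y => [a m b] [a' m' b']; rewrite !muE /=.
rewrite (tri_decomp (Triangular a m b)) (tri_decomp (Triangular a' m' b')) /=.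
rewrite !NDl !NDr.
rewrite !(NC (iM _) _ (iA _)) !(NC (iB _) _ (iA _)) !(NC (iM _) _ (iB _)).
by do 10?apply: centerD => //.
Qed.

End CentralizingTrace.

(** * From a proper trace to a Jordan homomorphism *)

Section QuadraticElements.
Variables (R : comNzRingType) (half_R : exists h : R, h *+ 2 = 1).

Lemma center_half (A : algType R) (u : A) : center A (u + u) -> center A u.
Proof.
by move=> cu x; apply: (double_inj half_R); rewrite -mulrDl cu mulrDr.
Qed.

(* Comparing the equations of a and a + 1 gives a * a = - a; applying this to
   a + a as well gives a = 0. *)
Lemma exists_nonquadratic (A : algType R) :
    central_torsion_free A -> (exists a, ~ center A a) ->
  ~ forall a, ~ center A a -> exists e c : A,
      [/\ center A e, center A c, e <> 0 & e * (a * a) + c * a = 0].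
Proof.
move=> tfA [a0 nca0] quad.
have ncD a c : center A c -> ~ center A a -> ~ center A (a + c).
  move=> cc nca cac; apply: nca; rewrite -(addrK c a); exact: centerB.
have sqrE a : ~ center A a -> a * a = - a.
  move=> nca; have [e [c [ce cc eN0 eqa]]] := quad a nca.
  have [e' [c' [ce' cc' e'N0 eqa1]]] := quad _ (ncD a 1 (@center1 _ A) nca).
  (* The coefficient of a that remains once a * a is eliminated between the equations for a and a +
     1. *)
  pose q := e * (e' + e' + c') - e' * c.
  have cq : center A q by repeat (apply: centerB || apply: centerM || apply: centerD).
  have eq1 : q * a + e * (e' + c') = 0.
    have : e * (e' * ((a + 1) * (a + 1)) + c' * (a + 1))
      - e' * (e * (a * a) + c * a) = 0 by rewrite eqa eqa1 !mulr0 subrr.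
    by apply: etrans; rewrite /q; ncring [:: e; e'; c; c'].
  have q0 : q = 0.
    have qaE : q * a = - (e * (e' + c')) by apply/eqP; rewrite -addr_eq0 eq1.
    have cqa : center A (q * a) by rewrite qaE; apply/centerN/centerM/centerD.
    by case: (central_mul_central tfA cq cqa).
  have {}eq1 : e' + c' = 0.
    by move: eq1; rewrite q0 mul0r add0r => /(tfA _ _ ce)[].
  have eq2 : e' * (e - c) = 0.
    rewrite -q0 -[LHS]addr0 -(mulr0 e) -eq1 /q.
    by ncring [:: e; e'; c; c'].
  have {eq2} /subr0_eq ec : e - c = 0 by case: (tfA _ _ ce' eq2).
  have /(tfA _ _ ce)[//|/eqP] : e * (a * a + a) = 0 by rewrite mulrDr {2}ec.
  by rewrite addr_eq0 => /eqP.
have nc2 : ~ center A (a0 + a0) by move/center_half.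
have sqr0 := sqrE _ nca0; apply: nca0; have := sqrE _ nc2.
rewrite mulrDl !mulrDr sqr0 => /eqP; rewrite -subr_eq0 => /eqP eq4.
suff -> : a0 = 0 by exact: center0.
apply: (double_eq0 half_R); apply: oppr_inj; rewrite oppr0 -eq4.
by ncring (@nil A).
Qed.

Variables (A B : algType R) (M : bimodType A B).
Local Notation T := (triangular M).
Hypotheses (faithl : left_faithful M) (faithr : right_faithful M).
Hypothesis loyalM : loyal M.
Hypothesis piA_center : pi_A @` center T = center A.
Hypothesis noncentralA : exists a : A, ~ center A a.
Let torsionA := central_torsion_freeA faithl loyalM piA_center.
Implicit Types (t : T) (a : A) (m : M).

Lemma quadratic_coefficient_eq0 (E : T -> T) :
    {morph E : x y / x + y} -> (forall t, center T (E t)) ->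
    (forall t, exists2 c, center T c & center T (E t * (t * t) + c * t)) ->
  forall t, E t = 0.
Proof.
move=> ED cE quad; have EN := additiveN ED.
have EM m : E (inM m) = 0.
  apply: contrapT => EmN0; apply: (exists_nonquadratic torsionA noncentralA).
  move=> a nca.
  (* The zero B-entry makes the central element given by [quad] vanish, which produces a quadratic
     equation for an arbitrary noncentral a. *)
  have [t [tA tB EtN0]] : exists t, [/\ pi_A t = a, pi_B t = 0 & E t <> 0].
    have [E0|] := pselect (E (inA M a + inM m) = 0).
      exists (inA M a - inM m); split; rewrite ?pi_ring /= ?tri_zeros // => E1.
      apply: EmN0; apply: (double_eq0 half_R).
      move: E0 E1; rewrite !ED EN => E0 E1.
      have /= := congr2 (fun x y => x - y) E0 E1.
      by move/subr_eq_trans; apply; ncring (@nil T).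
    by exists (inA M a + inM m); rewrite !pi_ring /= !tri_zeros.
  have [c cc cquad] := quad t.
  exists (pi_A (E t)), (pi_A c); split; try exact: center_piA.
    by move/(center_piA_eq0 faithr (cE t)).
  have /(congr1 pi_A) : E t * (t * t) + c * t = 0.
    apply: (center_piB_eq0 faithl cquad).
    by rewrite !pi_ring tB !mulr0 addr0.
  by rewrite !pi_ring tA.
have E_noncentral t : ~ center A (pi_A t) -> E t = 0.
  move=> nca; apply: contrapT => EtN0; set e := E t in EtN0.
  have ce : center T e by apply: cE.
  (* [E] ignores the M-entry, so t may be shifted by any [inM n]. The coefficient c does not change
     either, since its variation times the noncentral [pi_A t] would be central. *)
  have quad_n n : exists2 c, center T c &
      center T (e * ((t + inM n) * (t + inM n)) + c * (t + inM n)).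
    by have := quad (t + inM n); rewrite ED EM addr0.
  have [c cc ct] := quad t.
  have {}quad_n n :
      center T (e * ((t + inM n) * (t + inM n)) + c * (t + inM n)).
    have [d cd dt] := quad_n n; suff -> : c = d by [].
    apply/subr0_eq/(center_piA_eq0 faithr); first exact: centerB.
    have ccd : center A (pi_A (c - d)) by apply/center_piA/centerB.
    have ccdt : center A (pi_A (c - d) * pi_A t); last first.
      by case: (central_mul_central torsionA ccd ccdt).
    have := centerB (center_piA ct) (center_piA dt).
    rewrite !pi_ring /= !tri_zeros mulrDl mulNr.
    by rewrite opprD addrACA subrr add0r.
  (* With M-entry m, the M-component of [quad_n] reads (e a + c) m = - m (e b) for the diagonal
     entries a, b of t; this says that [s] is central, and then so is e a. *)
  pose s : T := Triangular (pi_A e * pi_A t + pi_A c) 0 (- (pi_B e * pi_B t)).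
  have cs : center T s.
    apply: center_triP => //= m.
    have := center_piM (quad_n (m - pi_M t)).
    rewrite !pi_ring /= !tri_zeros (center_piM ce) (center_piM cc).
    rewrite [pi_M t + _]addrC subrK !tri_zeros lactDr => /eqP.
    rewrite addrAC addr_eq0 => /eqP.
    by rewrite lactDl lactA ractNr ractA -(center_lact m ce) lractA.
  apply: EtN0; apply: (center_piA_eq0 faithr) => //.
  have cet : center A (pi_A e * pi_A t); last first.
    by case: (central_mul_central torsionA (center_piA ce) cet).
  rewrite -(addrK (pi_A c) (_ * _)); apply: centerB (center_piA cs) _.
  exact: center_piA.
move=> t; have [ct|/E_noncentral //] := pselect (center A (pi_A t)).
have [a nca] := noncentralA.
have := E_noncentral (t + inA M a); rewrite ED (E_noncentral (inA M a)) //.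
rewrite addr0; apply => cta; apply: nca.
have -> : a = pi_A (t + inA M a) - pi_A t by rewrite pi_ring /= addrC addKr.
exact: centerB.
Qed.

End QuadraticElements.

Ltac center_closure :=
  repeat lazymatch goal with
    | |- center _ (_ - _) => apply: centerB
    | |- center _ (_ + _) => apply: centerD
    | |- center _ (_ * _) => apply: centerM
    | |- center _ 1 => exact: center1
    | |- _ => done
  end.

Definition affine_map (A : pzRingType) (z : A) (eta : A -> A) (x : A) : A :=
  z * x + eta x.

Section JordanFromProperTrace.
Variables (R : comNzRingType) (half_R : exists h : R, h *+ 2 = 1).
Variables (A B : algType R) (M : bimodType A B).
Local Notation T := (triangular M).
Hypotheses (faithl : left_faithful M) (faithr : right_faithful M).
Hypothesis loyalM : loyal M.
Hypothesis piA_center : pi_A @` center T = center A.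
Hypothesis noncentralA : exists a : A, ~ center A a.
Hypothesis noncentralB : exists b : B, ~ center B b.

Variables (D : T -> T -> T) (z : T) (eta : T -> T).
Hypothesis DC : forall x y, D x y = D y x.
Hypothesis DDl : forall w, {morph D^~ w : x y / x + y}.
Hypothesis D_jordan : forall x y, D (D (D x x) y) x = D (D x x) (D y x).
Hypothesis D_lie : forall x y w,
  comm_br (comm_br x y) w = D x (D y w) - D y (D x w).
Hypotheses (cz : center T z) (ceta : forall x, center T (eta x)).
Hypothesis etaD : {morph eta : x y / x + y}.
Hypothesis D_proper : forall x y, center T
  (D x y - z * (x * y + y * x) - (eta x + eta x) * y - (eta y + eta y) * x).

Local Notation phi := (affine_map z eta).

(** If z = 0, then [D_lie] writes m b = [[x, w], y], for x = [inA 1], w = [inM m], y = [inB b], as a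
    central combination of x, w and 1. The coefficient d of w is independent of m, so m b = d m and
    every b would be central. *)
Lemma proper_coefficient_neq0 : z <> 0.
Proof.
move=> z0; have [b ncb] := noncentralB; apply: ncb.
have D_mod x y : exists2 n, center T n &
    D x y = (eta x + eta x) * y + (eta y + eta y) * x + n.
  exists (D x y - z * (x * y + y * x) - (eta x + eta x) * y - (eta y + eta y) * x).
    exact: D_proper.
  by rewrite z0; ncring (@nil T).
pose x := @inA R A B M 1; pose y := @inB R A B M b.
have [d cd dE] : exists2 d, center T d &
    forall m : M, ract m b = lact (pi_A d) m.
  exists ((eta x + eta x) * (eta y + eta y) - (eta (D x y) + eta (D x y))).
    by center_closure.
  move=> m; pose w := @inM R A B M m.
  have [p cp pE] := D_mod w y; have [q cq qE] := D_mod x y.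
  have [r cr rE] := D_mod x (D w y); have [s cs sE] := D_mod w (D x y).
  pose u := (eta x + eta x) * p - (eta w + eta w) * q + r - s.
  have cu : center T u by rewrite /u; center_closure.
  pose v := (eta (D w y) + eta (D w y)) - (eta w + eta w) * (eta y + eta y).
  have lieE : comm_br (comm_br x w) y =
      v * x + ((eta x + eta x) * (eta y + eta y) - (eta (D x y) + eta (D x y))) * w
      + u.
    rewrite D_lie rE sE /v /u.
    move: (eta (D w y)) (eta (D x y)) (ceta (D w y)) (ceta (D x y)) => k k' ck ck'.
    have cex := ceta x; have cew := ceta w; have cey := ceta y.
    by rewrite pE qE; ncring [:: eta x; eta w; eta y; k; k'; p; q].
  clearbody v u; have /(congr1 pi_M) := lieE.
  rewrite /comm_br !pi_ring /= !tri_zeros (center_piM cu) lact1 => ->.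
  by rewrite !tri_zeros.
suff -> : b = pi_B d by apply: center_piB.
by apply: (ract_inj faithr) => m; rewrite dE center_lact.
Qed.

Lemma proper_trace_jordan x y : phi (D x y) = phi x * phi y + phi y * phi x.
Proof.
have phiD p q : phi (p + q) = phi p + phi q.
  by rewrite /affine_map etaD; ncring (@nil T).
pose eps p q := phi (D p q) - (phi p * phi q + phi q * phi p).
have ceps p q : center T (eps p q).
  pose n := D p q - z * (p * q + q * p) - (eta p + eta p) * q - (eta q + eta q) * p.
  have -> : eps p q = z * n + eta (D p q) - (eta p * eta q + eta p * eta q).
    have cp := ceta p; have cq := ceta q.
    by rewrite /eps /n /affine_map; ncring [:: z; eta p; eta q].
  by center_closure; apply: D_proper.
have phiDE p q : phi (D p q) = phi p * phi q + phi q * phi p + eps p q.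
  by rewrite /eps addrC subrK.
have DDr w p q : D w (p + q) = D w p + D w q by rewrite !(DC w) DDl.
(* Half the coefficient of p * p when the Jordan identity is expanded with phi p = z * p + eta p; it
   is additive in p because y stays fixed. *)
pose E p := eps y p * (z * z) + eps y p * (z * z).
have cE p : center T (E p) by rewrite /E; center_closure.
have E0 : forall p, E p = 0.
  apply: (quadratic_coefficient_eq0 half_R faithl faithr loyalM piA_center) => //.
    by move=> p q; rewrite /E /eps DDr !phiD; ncring (@nil T).
  move=> p; set e1 := eps p p; set e2 := eps (D p p) y; set e4 := eps y p.
  pose e3 := eps (D (D p p) y) p; pose e5 := eps (D p p) (D y p).
  have ce1 : center T e1 by apply: ceps.
  have ce2 : center T e2 by apply: ceps.
  have ce4 : center T e4 by apply: ceps.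
  (* Applying phi to [D_jordan], the error-free terms cancel by the Jordan identity in T, and only
     terms containing an error remain. *)
  have quad_phi : (e2 * phi p + e2 * phi p) + e3 =
     (e4 * (phi p * phi p) + e4 * (phi p * phi p)) +
     (e4 * (phi p * phi p) + e4 * (phi p * phi p)) + (e1 * e4 + e1 * e4) + e5.
    have := congr1 phi (D_jordan p y).
    rewrite phiDE [phi (D (D p p) (D y p))]phiDE [phi (D (D p p) y)]phiDE.
    rewrite [phi (D p p)]phiDE [phi (D y p)]phiDE -/e1 -/e2 -/e3 -/e4 -/e5.
    by move/subr_eq_trans; apply; ncring [:: e1; e2; e4].
  exists ((e4 * z * eta p + e4 * z * eta p) + (e4 * z * eta p + e4 * z * eta p)
          - e2 * z).
    by center_closure.
  apply: (center_half half_R).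
  pose k := e3 - e5 - (e1 * e4 + e1 * e4) + (e2 * eta p + e2 * eta p)
    - ((e4 * (eta p * eta p) + e4 * (eta p * eta p)) +
       (e4 * (eta p * eta p) + e4 * (eta p * eta p))).
  have -> : E p * (p * p) + ((e4 * z * eta p + e4 * z * eta p)
      + (e4 * z * eta p + e4 * z * eta p) - e2 * z) * p
      + (E p * (p * p) + ((e4 * z * eta p + e4 * z * eta p)
      + (e4 * z * eta p + e4 * z * eta p) - e2 * z) * p) = k.
    have cp := ceta p; apply/esym; move/subr_eq_trans: quad_phi; apply.
    rewrite /affine_map.
    by rewrite /k /E -/e4; ncring [:: e1; e2; e4; z; eta p].
  have ce3 : center T e3 by apply: ceps.
  have ce5 : center T e5 by apply: ceps.
  by rewrite /k; center_closure.
have eps_yx0 : eps y x = 0.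
  have /(double_eq0 half_R) := E0 x.
  case/(center_integral faithl faithr loyalM (ceps y x) (centerM cz cz)) => //.
  case/(center_integral faithl faithr loyalM cz cz) => /proper_coefficient_neq0 //.
have eps0 : eps x y = 0 by rewrite -eps_yx0 /eps DC; ncring (@nil T).
by rewrite phiDE eps0 addr0.
Qed.

(** Since phi carries [D] to the Jordan product, [D_lie] shows that it respects second commutators;
    inside commutators phi is multiplication by z. *)
Lemma jordan_lie x y w : phi (comm_br (comm_br x y) w) =
  z * z * z * comm_br (comm_br x y) w.
Proof.
have phiB p q : phi (p - q) = phi p - phi q.
  by rewrite /affine_map etaD (additiveN etaD); ncring (@nil T).
rewrite {1}D_lie phiB !proper_trace_jordan /comm_br /affine_map.
have cx := ceta x; have cy := ceta y; have cw := ceta w.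
by ncring [:: z; eta x; eta y; eta w].
Qed.

Lemma proper_coefficient_sqr : z * z = 1.
Proof.
have zzz : z * z * z = z.
  apply/subr0_eq/(center_piA_eq0 faithr).
    by center_closure.
  apply: faithl => m.
  have /(congr1 pi_M) := jordan_lie (inA M 1) (inM m) (inA M 1).
  rewrite /affine_map /comm_br !pi_ring /= !tri_zeros (center_piM (ceta _)).
  rewrite addr0 !lact1.
  by rewrite !lactNr => /oppr_inj; rewrite lactDl lactNl => ->; rewrite subrr.
have : z * (z * z - 1) = 0 by rewrite mulrBr mulr1 mulrA zzz subrr.
case/(center_integral faithl faithr loyalM cz).
- by center_closure.
- by move/proper_coefficient_neq0.
by move/subr0_eq.
Qed.

Lemma proper_coefficient_pm1 : z = 1 \/ z = - 1.
Proof.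
have : (z - 1) * (z + 1) = 0.
  by rewrite mulrBl mul1r mulrDr mulr1 proper_coefficient_sqr; ncring (@nil T).
have c1 := @center1 _ T.
case/(center_integral faithl faithr loyalM (centerB cz c1) (centerD cz c1)).
  by move/subr0_eq; left.
by move/eqP; rewrite addr_eq0 => /eqP; right.
Qed.

Lemma eta_lie x y w : eta (comm_br (comm_br x y) w) = 0.
Proof.
have := jordan_lie x y w; rewrite proper_coefficient_sqr mul1r /affine_map.
by rewrite -[X in _ = X]addr0 => /addrI.
Qed.

End JordanFromProperTrace.

(** * Lie triple isomorphisms *)

Lemma comm_brDl (R : comNzRingType) (A : algType R) (x y w : A) :
  comm_br (x + y) w = comm_br x w + comm_br y w.
Proof. by rewrite /comm_br; ncring (@nil A). Qed.

Lemma centerP (R : comNzRingType) (A : algType R) (c : A) :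
  (forall x, comm_br c x = 0) -> center A c.
Proof. by move=> cc x; apply/subr0_eq/cc. Qed.

Lemma comm_br_center (R : comNzRingType) (A : algType R) (c x : A) :
  center A c -> comm_br c x = 0.
Proof. by move=> cc; rewrite /comm_br cc subrr. Qed.

(** Makes centrality detectable by second commutators, the only brackets that [l] preserves. *)
Lemma center_of_commutators_center (R : comNzRingType) (A B : algType R)
    (M : bimodType A B) (faithl : left_faithful M) (faithr : right_faithful M)
    (x : triangular M) :
  (forall y, center (triangular M) (comm_br x y)) -> center (triangular M) x.
Proof.
move=> cx; apply: center_triP => // [|m].
  have := center_piM (cx (inA M 1)).
  rewrite /comm_br !pi_ring /= !tri_zeros lact1 => /eqP.
  by rewrite oppr_eq0 => /eqP.
have := center_piM (cx (inM m)).
by rewrite /comm_br !pi_ring /= !tri_zeros => /subr0_eq.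
Qed.

Section LieTriple.
Variables (R : comNzRingType) (S T : algType R) (l : {linear S -> T}).
Variable g : T -> S.
Hypotheses (lK : cancel l g) (gK : cancel g l).
Hypothesis l_lie : forall a b c,
  l (comm_br (comm_br a b) c) = comm_br (comm_br (l a) (l b)) (l c).

Definition transported_jordan (x y : T) : T := l (jordan_mul (g x) (g y)).
Local Notation D := transported_jordan.

Lemma linear_inverse : linear g.
Proof. by move=> k x y; apply: (can_inj lK); rewrite linearP !gK. Qed.

Lemma transported_jordanC x y : D x y = D y x.
Proof. by rewrite /D /jordan_mul addrC. Qed.

Lemma transported_jordan_linear y : linear (D^~ y).
Proof.
move=> k x x'; rewrite /D linear_inverse -linearP /jordan_mul; congr (l _).
rewrite mulrDl mulrDr -scalerAl -scalerAr scalerDr.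
by rewrite addrACA.
Qed.

Lemma transported_jordan_jordan x y : D (D (D x x) y) x = D (D x x) (D y x).
Proof. by rewrite /D !lK /jordan_mul; congr (l _); ncring (@nil S). Qed.

Lemma comm_br2_transported x y w :
  comm_br (comm_br x y) w = D x (D y w) - D y (D x w).
Proof.
rewrite -[x in LHS]gK -[y in LHS]gK -[w in LHS]gK -l_lie /D !lK -linearB.
by congr (l _); rewrite /comm_br /jordan_mul; ncring (@nil S).
Qed.

Lemma transported_jordan_cyclic x y w :
  center T (comm_br (D x y) w + comm_br (D y w) x + comm_br (D w x) y).
Proof.
rewrite -(gK x) -(gK y) -(gK w); move: (g x) (g y) (g w) => a b c.
apply: centerP => v; rewrite -(gK v) 2!comm_brDl /D !lK -!l_lie -!linearD.
by rewrite -[RHS](linear0 l); congr (l _); rewrite /comm_br /jordan_mul;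
  ncring (@nil S).
Qed.

Lemma transported_jordan_diag x : center T (comm_br (D x x) x).
Proof.
rewrite -(gK x); move: (g x) => a; apply: centerP => v.
rewrite -(gK v) /D !lK -!l_lie -[RHS](linear0 l).
by congr (l _); rewrite /comm_br /jordan_mul; ncring (@nil S).
Qed.

End LieTriple.

(** Uniqueness of mu: the defect d of linearity is central and d * y is central for y = [inA 1]. As
    d * y has zero B-entry it vanishes, and with it d. *)
Lemma proper_trace_linear (R : comNzRingType) (A B : algType R)
    (M : bimodType A B) (faithr : right_faithful M) (faithl : left_faithful M)
    (D : triangular M -> triangular M -> triangular M) (z : triangular M)
    (mu : triangular M -> triangular M) :
    (forall y, linear (D^~ y)) -> center (triangular M) z ->
    (forall x, center (triangular M) (mu x)) ->
    (forall x y, center (triangular M)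
       (D x y - z * (x * y + y * x) - mu x * y - mu y * x)) ->
  linear mu.
Proof.
move=> Dlin cz cmu Dmu k x x'; set T := triangular M.
apply/subr0_eq; set d := (X in X = 0).
(* The scalar k is replaced by multiplication by a central element, which [ncring] can handle. *)
have [c cc kE] : exists2 c, center T c & forall u : T, k *: u = c * u.
  exists k%:A => u; last by rewrite mulr_algl.
  by rewrite mulr_algl mulr_algr.
have cd : center T d.
  by rewrite /d; apply: centerB => //; apply: centerD => //; apply: centerZ.
pose y : T := inA M 1.
suff cdy : center T (d * y).
  have dy0 : d * y = 0.
    by apply: (center_piB_eq0 faithl cdy); rewrite pi_ring mulr0.
  apply: (center_piA_eq0 faithr cd).
  by have /(congr1 pi_A) := dy0; rewrite pi_ring mulr1.
pose C u := D u y - z * (u * y + y * u) - mu u * y - mu y * u.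
have -> : d * y = c * C x + C x' - C (k *: x + x').
  rewrite /C /d Dlin !kE.
  have cx := cmu x; have cx' := cmu x'; have cy := cmu y.
  by ncring [:: c; z; mu x; mu x'; mu y].
by apply: centerB; [apply: centerD; [apply: centerM|]|]; rewrite // /C; apply: Dmu.
Qed.

Theorem theorem4p4 (R : comNzRingType) (half_R : exists h : R, h *+ 2 = 1)
  (A B : algType R) (M : bimodType A B)
  (faithl : left_faithful M) (faithr : right_faithful M)
  (A' B' : algType R) (M' : bimodType A' B')
  (faithl' : left_faithful M') (faithr' : right_faithful M')
  (l : {linear triangular M -> triangular M'})
  (lie_l : lie_triple_isomorphism l)
  (properA' : forall f : {linear A' -> A'}, commuting f -> proper_map f)
  (properB' : forall f : {linear B' -> B'}, commuting f -> proper_map f)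
  (centerA' : pi_A @` center (triangular M') = center A')
  (centerA'_neq : center A' <> [set: A'])
  (centerB' : pi_B @` center (triangular M') = center B')
  (centerB'_neq : center B' <> [set: B'])
  (noncomm : ~ (forall x y : A, x * y = y * x) \/
             ~ (forall x y : B, x * y = y * x))
  (loyal_M' : loyal M') :
  exists m n : {linear triangular M -> triangular M'},
    [/\ (forall x, l x = m x + n x) \/ (forall x, l x = - m x + n x),
        jordan_homomorphism m /\ injective m,
        forall x, center (triangular M') (n x),
        forall x y z, n (comm_br (comm_br x y) z) = 0 &
        central_over (triangular M') -> range m = [set: triangular M']].
Proof.
have [[g lK gK] l_lie] := lie_l; have [h h2] := half_R.
set S := triangular M in l lie_l g lK gK l_lie *.
set T := triangular M' in l lie_l g lK gK l_lie *.
pose D := transported_jordan l g.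
have DC x y : D x y = D y x by apply: transported_jordanC.
have Dlin := transported_jordan_linear lK gK : forall y, linear (D^~ y).
have ncA := center_neq_setT centerA'_neq.
have ncB := center_neq_setT centerB'_neq.
have [z [mu [cz cmu Dmu]]] := centralizing_trace_proper half_R faithl' faithr'
  loyal_M' properA' properB' centerA' centerB' ncA ncB DC Dlin
  (transported_jordan_cyclic lK gK l_lie) (transported_jordan_diag lK gK l_lie).
have mu_lin := proper_trace_linear faithr' faithl' Dlin cz cmu Dmu.
pose eta x := h *: mu x.
have eta2 x : eta x + eta x = mu x by rewrite /eta -scalerDl -mulr2n h2 scale1r.
have eta_lin : linear eta.
  by move=> k x y; rewrite /eta mu_lin scalerDr !scalerA mulrC.
have etaD : {morph eta : x y / x + y}.
  by move=> x y; have := eta_lin 1 x y; rewrite !scale1r.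
have ceta x : center T (eta x) by apply: centerZ.
have DDl w : {morph D^~ w : x y / x + y}.
  by move=> x y; have := Dlin w 1 x y; rewrite !scale1r.
have D_proper x y : center T (D x y - z * (x * y + y * x)
    - (eta x + eta x) * y - (eta y + eta y) * x) by rewrite !eta2.
have D_jordan : forall x y, D (D (D x x) y) x = D (D x x) (D y x).
  exact: transported_jordan_jordan.
have D_lie := comm_br2_transported lK gK l_lie : forall x y w,
  comm_br (comm_br x y) w = D x (D y w) - D y (D x w).
clearbody eta.
have phi_jordan := proper_trace_jordan half_R faithl' faithr' loyal_M' centerA'
  ncA ncB DC DDl D_jordan D_lie cz ceta etaD D_proper.
have zz := proper_coefficient_sqr half_R faithl' faithr' loyal_M' centerA'
  ncA ncB DC DDl D_jordan D_lie cz ceta etaD D_proper.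
have z_pm1 := proper_coefficient_pm1 half_R faithl' faithr' loyal_M' centerA'
  ncA ncB DC DDl D_jordan D_lie cz ceta etaD D_proper.
have etal := eta_lie half_R faithl' faithr' loyal_M' centerA'
  ncA ncB DC DDl D_jordan D_lie cz ceta etaD D_proper.
have [m mE] : exists m : {linear S -> T}, forall x, m x = z * l x + eta (l x).
  apply: linear_bundle => k x y.
  by rewrite linearP eta_lin mulrDr -scalerAr scalerDr addrACA.
(* This is l - z * m, computed with z * z = 1. *)
have [n nE] : exists n : {linear S -> T}, forall x, n x = - (z * eta (l x)).
  apply: linear_bundle => k x y.
  by rewrite linearP eta_lin mulrDr -scalerAr opprD scalerN.
have lE x : l x = z * m x + n x.
  by rewrite mE nE mulrDr mulrA zz mul1r addrK.
have cn x : center T (n x) by rewrite nE; apply/centerN/centerM.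
have m_jordan x y : m (jordan_mul x y) = jordan_mul (m x) (m y).
  rewrite !mE; have := phi_jordan (l x) (l y).
  by rewrite /affine_map /D /transported_jordan !lK.
have center_l x : center T (l x) -> center S x.
  move=> clx; apply: (center_of_commutators_center faithl faithr) => y.
  apply: centerP => w; apply: (can_inj lK); rewrite l_lie linear0.
  by rewrite (comm_br_center _ clx) /comm_br mul0r mulr0 subrr.
have ker_center x : m x = 0 -> center S x.
  by move=> mx; apply: center_l; rewrite lE mx mulr0 add0r.
(* The kernel consists of central elements and is stable under Jordan multiplication, so x o [inM v]
   = 2 x (inM v) is central; its M-entry must be zero. *)
have ker_m x : m x = 0 -> x = 0.
  move=> mx; have cx := ker_center x mx.
  have cxx y : center S (jordan_mul x y).
    by apply: ker_center; rewrite m_jordan mx /jordan_mul mul0r mulr0 addr0.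
  apply: (center_piA_eq0 faithr cx); apply: faithl => v.
  have := center_piM (cxx (inM v)); rewrite /jordan_mul -cx pi_ring.
  by move/(double_eq0 half_R); rewrite !pi_ring /= !tri_zeros.
have m_inj : injective m.
  by move=> x y mxy; apply/subr0_eq/ker_m; rewrite linearB mxy subrr.
exists m, n; split=> //.
- case: z_pm1 => z1; [left | right] => x; rewrite {1}lE z1 ?mul1r //.
  by rewrite mulN1r.
- by move=> x y w; rewrite nE l_lie etal mulr0 oppr0.
move=> central_T; apply/seteqP; split=> // Y _.
(* [m 1] is central and acts as identity on the range of m, so it is an idempotent; it is nonzero by
   injectivity, and the center has no zero divisors. *)
have m1 : m 1 = 1.
  have cm1 : center T (m 1).
    rewrite mE; apply: centerD => //; apply: centerM => //.
    apply: (center_of_commutators_center faithl' faithr') => W.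
    apply: centerP => V; rewrite -(gK W) -(gK V) -l_lie.
    by rewrite (comm_br_center _ (@center1 _ _)) /comm_br mul0r mulr0 subrr linear0.
  have m1x x : m x = m 1 * m x.
    apply: (double_inj half_R); rewrite -linearD.
    have := m_jordan 1 x; rewrite /jordan_mul mul1r mulr1 => ->.
    by rewrite -cm1.
  have : m 1 * (m 1 - 1) = 0 by rewrite mulrBr mulr1 -m1x subrr.
  case/(center_integral faithl' faithr' loyal_M' cm1).
  + by apply: centerB => //; apply: center1.
  + by move/ker_m/eqP; rewrite oner_eq0.
  by move/subr0_eq.
(* When the center consists of scalars, the central part of Y = l (g Y) is a multiple of 1 = m 1 and
   lies in the range of m. *)
have := cn (g Y); rewrite central_T => -[k _ kE].
have YE : Y = z * m (g Y) + k%:A by rewrite kE -lE gK.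
case: z_pm1 => z1; rewrite z1 ?mul1r ?mulN1r in YE.
  by exists (g Y + k%:A); rewrite // linearD linearZ m1 -YE.
by exists (- g Y + k%:A); rewrite // linearD linearN linearZ m1 -YE.
Qed.
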